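(* Let $\mathcal{A}$ be a (not necessarily unital) operator algebra. The following are equivalent: (i) $\mathcal{A}$ is residually finite dimensional (RFD); (ii) for every representation $\pi$ of $\mathcal{A}$ on a Hilbert space $\mathcal{H}$, there exist a net $(\pi_\lambda)$ of finite dimensional representations of $\mathcal{A}$ on $\mathcal{H}$ and an increasing net $(P_\lambda)$ (over the same index set) of finite rank orthogonal projections on $\mathcal{H}$ so that $\pi(a) = \lim_\lambda P_\lambda \pi_\lambda(a) P_\lambda$ in the SOT-$*$ topology for all $a \in \mathcal{A}$; (iii) for every representation $\pi: \mathcal{A} \to B(\mathcal{H})$ on a Hilbert space $\mathcal{H}$, there exists a net $(\pi_\lambda)$ of finite dimensional representations $\pi_\lambda: \mathcal{A} \to B(\mathcal{H})$ such that $(\pi_\lambda(a))$ converges to $\pi(a)$ in the weak operator topology (WOT) for all $a \in \mathcal{A}$.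
   Context: An operator algebra is a norm closed (not necessarily self-adjoint) subalgebra $\mathcal{A} \subset B(\mathcal{K})$ for some complex Hilbert space $\mathcal{K}$. The space $M_n(\mathcal{A})$ is normed as a subspace of $M_n(B(\mathcal{K})) = B(\mathcal{K}^n)$. A representation of $\mathcal{A}$ is a completely contractive homomorphism $\pi: \mathcal{A} \to B(\mathcal{H})$ for some Hilbert space $\mathcal{H}$; $\pi^{(n)}$ denotes the entrywise application of $\pi$ to $n \times n$ matrices. $\mathcal{A}$ is residually finite dimensional (RFD) if for every $n \in \mathbb{N}$ and every $a \in M_n(\mathcal{A})$, $\|a\| = \sup \|\pi^{(n)}(a)\|$, where the supremum is over all representations $\pi: \mathcal{A} \to B(\mathcal{H})$ with $\dim \mathcal{H} < \infty$. A representation $\pi: \mathcal{A} \to B(\mathcal{H})$ is finite dimensional if the closed linear span of $C^*(\pi(\mathcal{A}))\mathcal{H}$ is finite dimensional, where $C^*(\pi(\mathcal{A}))$ is the $C^*$-algebra generated by $\pi(\mathcal{A})$ ($\mathcal{H}$ itself may be infinite dimensional). Convergence $T_\lambda \to T$ in SOT-$*$ means that $T_\lambda \to T$ and $T_\lambda^* \to T^*$ in the strong operator topology. *)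

(* Defs.v *)
From HB Require Import structures.
From mathcomp Require Import all_boot all_order all_algebra.
From mathcomp Require Import sesquilinear complex.
From mathcomp Require Import all_classical all_reals all_analysis.

Set Implicit Arguments.
Unset Strict Implicit.
Unset Printing Implicit Defensive.

Import Order.TTheory GRing.Theory Num.Theory.
Import numFieldNormedType.Exports.

Local Open Scope classical_set_scope.
Local Open Scope ring_scope.
Local Open Scope complex_scope.

(* Complex Hilbert spaces; the inner product is linear in its first argument
   and conjugate-linear in the second one. *)
Record hilbertType (R : realType) := Hilbert {
  hilbert_sort :> completeNormedModType R[i];
  inner : {dot hilbert_sort for @Num.conj R[i]};
  inner_norm : forall x : hilbert_sort, `|x| ^+ 2 = inner x x }.

Section Hilbert.
Variables (R : realType) (H : hilbertType R).
Implicit Types (x y : H) (S T P : H -> H) (E : set H) (B : set (H -> H)).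

(* The norm of H takes its values in R[i]; this is the same norm, in R. *)
Definition hnorm x : R := complex.Re `|x|.

Definition is_subspace E :=
  E 0 /\ forall (c : R[i]) x y, E x -> E y -> E (c *: x + y).

Definition lin_span E : set H := smallest is_subspace E.

Definition finite_dim E := exists n (v : 'I_n -> H), E `<=` lin_span (range v).

Definition bounded_ops : set (H -> H) :=
  [set T | linear T /\ exists M : R, forall x, hnorm (T x) <= M * hnorm x].

Definition opnorm T : R := sup [set hnorm (T x) | x in [set x | hnorm x <= 1]].

(* The norm of an n x n matrix of operators acting on the Hilbert space H^n. *)
Definition l2norm n (x : 'I_n -> H) : R :=
  Num.sqrt (\sum_(i < n) hnorm (x i) ^+ 2).

Definition mxop n (a : 'M[H -> H]_n) (x : 'I_n -> H) : 'I_n -> H :=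
  fun i => \sum_(j < n) a i j (x j).

Definition mxopnorm n (a : 'M[H -> H]_n) : R :=
  sup [set l2norm (mxop a x) | x in [set x | l2norm x <= 1]].

Definition is_adjoint T S := forall x y, inner H (T x) y = inner H x (S y).

(* A bounded operator has exactly one adjoint (Riesz), so the default value
   plays no role on bounded_ops. *)
Definition adjoint T : H -> H := xget 0 [set S | is_adjoint T S].

Definition is_operator_algebra B :=
  [/\ B `<=` bounded_ops,
      B 0,
      (forall (c : R[i]) S T, B S -> B T -> B (c *: S + T)),
      (forall S T, B S -> B T -> B (S \o T)) &
      (forall T, bounded_ops T ->
        (forall e : R, 0 < e -> exists2 S, B S & opnorm (T - S) < e) -> B T)].

Definition is_Cstar_algebra B :=
  is_operator_algebra B /\ forall T, B T -> B (adjoint T).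

Definition Cstar (B : set (H -> H)) := smallest is_Cstar_algebra B.

Definition is_projection P :=
  [/\ bounded_ops P, P \o P = P & adjoint P = P].

Definition finite_rank T := finite_dim (range T).

Definition op_le S T := forall x, 0 <= inner H (T x - S x) x.

End Hilbert.

Record directedType := Directed {
  directed_sort :> Type;
  dle : directed_sort -> directed_sort -> Prop;
  dle_refl : forall i, dle i i;
  dle_trans : forall i j k, dle i j -> dle j k -> dle i k;
  dle_directed : forall i j, exists k, dle i k /\ dle j k;
  directed_inhabited : inhabited directed_sort }.

Section Nets.
Variables (I : directedType) (R : realType) (H : hilbertType R).
Implicit Types (u : I -> H -> H) (T : H -> H).

(* A net f : I -> X converges to l when f @ tails --> l. *)
Definition tails : set_system I :=
  filter_from [set: I] (fun i => [set j | dle i j]).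

Definition increasing_net u := forall i j, dle i j -> op_le (u i) (u j).

Definition SOT_cvg u T := forall x, (fun i => u i x) @ tails --> T x.

Definition SOTstar_cvg u T :=
  SOT_cvg u T /\ SOT_cvg (fun i => adjoint (u i)) (adjoint T).

Definition WOT_cvg u T :=
  forall x y, (fun i => inner H (u i x) y) @ tails --> inner H (T x) y.

End Nets.

Section Representations.
Variables (R : realType) (K : hilbertType R) (A : set (K -> K)).

(* A map on A is encoded as a map on all functions K -> K, of which only the
   values on A matter; map_mx pi a is the amplification of pi at a. *)
Definition is_representation (H : hilbertType R)
    (pi : (K -> K) -> (H -> H)) :=
  [/\ (forall a, A a -> bounded_ops (pi a)),
      (forall (c : R[i]) a b, A a -> A b -> pi (c *: a + b) = c *: pi a + pi b),
      (forall a b, A a -> A b -> pi (a \o b) = pi a \o pi b) &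
      (forall n (a : 'M[K -> K]_n), (forall i j, A (a i j)) ->
        mxopnorm (map_mx pi a) <= mxopnorm a)].

Definition finite_dim_representation (H : hilbertType R)
    (pi : (K -> K) -> (H -> H)) :=
  is_representation pi /\
  finite_dim (closure (lin_span
    [set y | exists2 T, Cstar (pi @` A) T & exists x, y = T x])).

Definition RFD := forall n (a : 'M[K -> K]_n), (forall i j, A (a i j)) ->
  mxopnorm a = sup [set r | exists H : hilbertType R,
    finite_dim [set: H] /\ exists2 pi : (K -> K) -> (H -> H),
      is_representation pi & r = mxopnorm (map_mx pi a)].

End Representations.

(* Main.v *)
Require Import Defs.
From HB Require Import structures.
From mathcomp Require Import all_boot all_order all_algebra.
From mathcomp Require Import sesquilinear spectral complex ring lra.
From mathcomp Require Import all_classical all_reals all_analysis.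

Set Implicit Arguments.
Unset Strict Implicit.
Unset Printing Implicit Defensive.

Import Order.TTheory GRing.Theory Num.Theory.
Import numFieldNormedType.Exports.

Local Open Scope classical_set_scope.
Local Open Scope ring_scope.

(** Why the theorem is true.

    Both (ii) and (iii) give (i) by lower semicontinuity of the norm: apply them
    to the identity representation of A on K.  The coefficients <ax, y> of a
    matrix a over A are then limits of coefficients of finite dimensional
    representations at vectors of no larger norm, and a finite dimensional
    representation on K restricts to a space of finite dimension that contains
    these vectors (rfd_of_approximation, rfd_of_compressions).  It remains to
    derive (ii) and (iii) from (i), and one net does both
    (rfd_approximating_net).  If H has finite dimension, pi itself is a finite
    dimensional representation.

    Let H be infinite dimensional, F a subspace of finite dimension with
    orthonormal basis e, and a_1, ..., a_m in A.  The heart of the proof is that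
    the compressions of the pi(a_j) to F are approximated by compressions of
    rho(a_j), where rho is a representation on H with finite dimensional
    carrier (finite_rank_approximation).  Since H is infinite dimensional, such
    representations can be moved to orthogonal copies and added.  Therefore the
    points (<v_l, v_p>, <rho(a_j)v_l, v_p>), for all such rho and all tuples v
    in the carrier of rho, form a convex cone, and this cone comes close to the
    point of pi and e (sample_near_cone); otherwise, a functional separates.
    The functional has the form v |-> <Dv, v> + Re <rho(b)v, v> with a scalar
    hermitian matrix D and a matrix b over A.  After adding a small multiple of
    the identity to D it is positive on the cone, and still negative at the point
    of pi and e; by the case rho = 0, D is then positive definite, say
    D = S^*S, and with b = 2 S^* x S the functional becomes |w|^2 + 2 Re
    <rho(x)w, w> at w = Sv.

    So one has to pass from 1 + 2 Re rho(x) >= 0 for all rho of finite dimension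
    to 1 + 2 Re pi(x) >= 0, which contradicts the separation
    (real_part_transfer).  The inequality says that x/(1 + x) is a contraction.
    Polynomials in x without constant term approximate x/(1 + x), with errors
    that are controlled in all representations of finite dimension; these
    polynomials belong to the matrices over A, so that (i) carries the estimates
    over to A and then to pi.

    Once the cone is close, the Gram matrix of v is almost the identity.  Scaled
    down slightly, v becomes a contraction; adding its defect operator, with
    values orthogonal to the carrier of rho, turns v into an orthonormal tuple
    without changing the compressions (almost_orthonormal_dilation).  A partial
    isometry that sends this tuple to e finishes the approximation.

    The net is indexed by finite sets of vectors, finite sets of elements of A
    and precisions; P is the projection onto the span F of the vectors.  As the
    compressions to F converge in norm, and F eventually contains x, pi(a)x and
    pi(a)^*x, the convergence is in SOT-* for P rho(a) P and in WOT for
    rho(a). *)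

(** * Scalars, inner products and tuples of vectors *)

Section Scalars.
Variable R : realType.
Implicit Types z w : R[i].

Definition cabs z : R := complex.Re `|z|.

Lemma cabsE z : `|z| = (cabs z)%:C%C.
Proof. by rewrite /cabs normc_def. Qed.

Lemma cabs_ge0 z : 0 <= cabs z.
Proof. by rewrite -ler0c -cabsE. Qed.

Lemma cabs0 : cabs 0 = 0.
Proof. by rewrite /cabs normr0. Qed.

Lemma cabsD z w : cabs (z + w) <= cabs z + cabs w.
Proof. by rewrite -lecR rmorphD -!cabsE ler_normD. Qed.

Lemma cabsM z w : cabs (z * w) = cabs z * cabs w.
Proof. by apply: complexI; rewrite rmorphM /= -!cabsE normrM. Qed.

Lemma cabsN z : cabs (- z) = cabs z.
Proof. by rewrite /cabs normrN. Qed.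

Lemma cabsJ z : cabs (Num.conj z) = cabs z.
Proof. by rewrite /cabs norm_conjC. Qed.

Lemma cabs_sum I (r : seq I) (P : pred I) (F : I -> R[i]) :
  cabs (\sum_(i <- r | P i) F i) <= \sum_(i <- r | P i) cabs (F i).
Proof.
elim/big_ind2: _ => //; first by rewrite cabs0.
by move=> a b c d h1 h2; apply: le_trans (cabsD _ _) (lerD h1 h2).
Qed.

Lemma ReD z w : complex.Re (z + w) = complex.Re z + complex.Re w.
Proof. by case: z; case: w. Qed.

Lemma ReB z w : complex.Re (z - w) = complex.Re z - complex.Re w.
Proof. by case: z; case: w. Qed.

Lemma Re_sum I (r : seq I) (P : pred I) (F : I -> R[i]) :
  complex.Re (\sum_(i <- r | P i) F i) =
  \sum_(i <- r | P i) complex.Re (F i).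
Proof. by elim/big_ind2: _ => // a b c d <- <-; rewrite ReD. Qed.

Lemma cRe_conj z : complex.Re (Num.conj z) = complex.Re z.
Proof. by case: z. Qed.

Lemma ReZ (a : R) z : complex.Re (a%:C%C * z) = a * complex.Re z.
Proof. by case: z => x y /=; rewrite mul0r subr0. Qed.

Lemma conj_real (a : R) : Num.conj (a%:C%C) = a%:C%C :> R[i].
Proof. exact: conjc_real. Qed.

Lemma ler_Re_cabs z : `|complex.Re z| <= cabs z.
Proof. by rewrite -lecR -cabsE normc_ge_Re. Qed.

Lemma ler_Im_cabs z : `|complex.Im z| <= cabs z.
Proof.
rewrite -lecR -cabsE normc_def lecR -sqrtr_sqr ler_sqrt.
  by rewrite lerDr sqr_ge0.
by rewrite addr_ge0 ?sqr_ge0.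
Qed.

Lemma cabs_le_Re_Im z : cabs z <= `|complex.Re z| + `|complex.Im z|.
Proof.
have -> : z = (complex.Re z)%:C%C + 'i%C * (complex.Im z)%:C%C.
  exact: complexE.
apply: le_trans (cabsD _ _) _; rewrite cabsM.
rewrite /cabs !normc_def /= !(expr0n, expr1n, addr0, add0r, mul0r, mulr0, mul1r).
by rewrite sqrtr1 !sqrtr_sqr !mul1r ?oppr0 ?(subr0, addr0, add0r).
Qed.

End Scalars.

Section DotProduct.
Variables (R : realType) (U : lmodType R[i]) (f : {dot U for @Num.conj R[i]}).
Implicit Types (x y z : U) (a : R[i]).

Definition dotnorm x : R := Num.sqrt (complex.Re (f x x)).

Lemma dotC x y : f x y = Num.conj (f y x).
Proof. by rewrite hermC expr0 mul1r. Qed.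

Lemma dotDl x y z : f (x + y) z = f x z + f y z.
Proof. exact: linearDl. Qed.
Lemma dotDr x y z : f z (x + y) = f z x + f z y.
Proof. exact: linearDr. Qed.
Lemma dotNl x z : f (- x) z = - f x z.
Proof. exact: linearNl. Qed.
Lemma dotNr x z : f z (- x) = - f z x.
Proof. exact: linearNr. Qed.
Lemma dotBl x y z : f (x - y) z = f x z - f y z.
Proof. exact: linearBl. Qed.
Lemma dotBr x y z : f z (x - y) = f z x - f z y.
Proof. exact: linearBr. Qed.
Lemma dotZl a x z : f (a *: x) z = a * f x z.
Proof. exact: linearZl_LR. Qed.
Lemma dotZr a x z : f z (a *: x) = Num.conj a * f z x.
Proof. exact: linearZr_LR. Qed.
Lemma dot0l z : f 0 z = 0.
Proof. exact: linear0l. Qed.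
Lemma dot0r z : f z 0 = 0.
Proof. exact: linear0r. Qed.
Lemma dot_suml I (r : seq I) (P : pred I) (E : I -> U) z :
  f (\sum_(i <- r | P i) E i) z = \sum_(i <- r | P i) f (E i) z.
Proof. exact: linear_sumlz. Qed.
Lemma dot_sumr I (r : seq I) (P : pred I) (E : I -> U) z :
  f z (\sum_(i <- r | P i) E i) = \sum_(i <- r | P i) f z (E i).
Proof. exact: linear_sumr. Qed.

Lemma dotnorm_ge0 x : 0 <= dotnorm x.
Proof. exact: sqrtr_ge0. Qed.

Lemma dot_sqr x : f x x = (dotnorm x ^+ 2)%:C%C.
Proof.
have h := dnorm_ge0 f x.
rewrite sqr_sqrtr; last by case: (f x x) h => a b; rewrite lecE => /andP[].
by case: (f x x) h => a b; rewrite lecE /= => /andP[/eqP -> _].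
Qed.

Lemma Re_dot_sqr x : complex.Re (f x x) = dotnorm x ^+ 2.
Proof. by rewrite dot_sqr. Qed.

Lemma dotnorm_eq0 x : dotnorm x = 0 -> x = 0.
Proof.
move=> h; apply/eqP; rewrite -(dnorm_eq0 f) dot_sqr h expr0n //=.
Qed.

Lemma dotnorm0 : dotnorm 0 = 0.
Proof. by rewrite /dotnorm dot0l sqrtr0. Qed.

Lemma dotnormZ a x : dotnorm (a *: x) = cabs a * dotnorm x.
Proof.
apply/eqP; rewrite -(@eqrXn2 _ 2) ?mulr_ge0 ?cabs_ge0 ?dotnorm_ge0 //; apply/eqP/complexI.
rewrite -dot_sqr dnormZ dot_sqr exprMn rmorphM /=.
by rewrite cabsE rmorphM !rmorphXn.
Qed.

Lemma dotnormN x : dotnorm (- x) = dotnorm x.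
Proof. by rewrite /dotnorm dotNl dotNr opprK. Qed.

Lemma dotnormB x y : dotnorm (x - y) = dotnorm (y - x).
Proof. by rewrite -dotnormN opprB. Qed.

Lemma dotnorm_sqrD x y :
  dotnorm (x + y) ^+ 2 =
  dotnorm x ^+ 2 + dotnorm y ^+ 2 + 2 * complex.Re (f x y).
Proof.
rewrite -!Re_dot_sqr dotDl !dotDr !ReD (dotC y x) cRe_conj; ring.
Qed.

Lemma dotnorm_sqrB x y :
  dotnorm (x - y) ^+ 2 =
  dotnorm x ^+ 2 + dotnorm y ^+ 2 - 2 * complex.Re (f x y).
Proof.
rewrite -!Re_dot_sqr dotBl !dotBr !ReB (dotC y x) cRe_conj; ring.
Qed.

Lemma dot_CS x y : cabs (f x y) <= dotnorm x * dotnorm y.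
Proof.
have [y0|nz] := eqVneq (dotnorm y) 0.
  by rewrite (dotnorm_eq0 y0) dot0r cabs0 dotnorm0 mulr0.
have yp : 0 < dotnorm y by rewrite lt_def nz dotnorm_ge0.
(* the vector |y|^2 x - <x, y> y is |y|^2 times the component of x orthogonal
   to y *)
have := sqr_ge0 (dotnorm ((dotnorm y ^+ 2)%:C%C *: x - f x y *: y)).
rewrite dotnorm_sqrB !dotnormZ dotZl dotZr ReZ.
have -> : Num.conj (f x y) * f x y = ((cabs (f x y)) ^+ 2)%:C%C.
  by rewrite mulrC -normCK cabsE rmorphXn.
rewrite /= {1}/cabs ger0_norm ?lecR ?sqr_ge0 //= => h.
rewrite -(@ler_pXn2r _ 2) ?nnegrE ?mulr_ge0 ?cabs_ge0 ?dotnorm_ge0 //.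
have : 0 <= dotnorm y ^+ 2 * ((dotnorm x * dotnorm y) ^+ 2 - cabs (f x y) ^+ 2).
  by apply: le_trans h _; rewrite le_eqVlt; apply/orP; left; apply/eqP; ring.
by rewrite pmulr_rge0 ?exprn_gt0 // subr_ge0.
Qed.

Lemma Re_dot_CS x y : complex.Re (f x y) <= dotnorm x * dotnorm y.
Proof.
exact: le_trans (le_trans (ler_norm _) (ler_Re_cabs _)) (dot_CS _ _).
Qed.

Lemma dotnormD x y : dotnorm (x + y) <= dotnorm x + dotnorm y.
Proof.
rewrite -(@ler_pXn2r _ 2) ?nnegrE ?addr_ge0 ?dotnorm_ge0 //.
rewrite dotnorm_sqrD; have := Re_dot_CS x y; lra.
Qed.

Lemma dotnorm_distD z x y :
  dotnorm (x - y) <= dotnorm (x - z) + dotnorm (z - y).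
Proof. by rewrite -(subrKA z x (-y)) dotnormD. Qed.

Lemma dotnorm_sum I (r : seq I) (P : pred I) (E : I -> U) :
  dotnorm (\sum_(i <- r | P i) E i) <= \sum_(i <- r | P i) dotnorm (E i).
Proof.
elim/big_ind2: _ => //; first by rewrite dotnorm0.
by move=> a b c d h1 h2; apply: le_trans (dotnormD _ _) (lerD h1 h2).
Qed.

Lemma dotnorm_le_dot x (M : R) : 0 <= M ->
  (forall y, cabs (f x y) <= M * dotnorm y) -> dotnorm x <= M.
Proof.
move=> M0 /(_ x); rewrite dot_sqr /cabs ger0_norm ?lecR ?sqr_ge0 //= => h.
have [/eqP->//|nz] := boolP (dotnorm x == 0).
by rewrite -(@ler_pM2r _ (dotnorm x)) ?lt_def ?nz ?dotnorm_ge0 // -expr2.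
Qed.

Lemma dot_ext x y : (forall z, f x z = f y z) -> x = y.
Proof.
move=> h; apply/subr0_eq/eqP; rewrite -(dnorm_eq0 f).
by rewrite dotBl h subrr.
Qed.

End DotProduct.

Section HilbertNorm.
Variables (R : realType) (H : hilbertType R).
Implicit Types x y : H.

Lemma hnormE x : hnorm x = dotnorm (inner H) x.
Proof.
apply/eqP; rewrite -(@eqrXn2 _ 2) ?dotnorm_ge0 //; last first.
  by rewrite -ler0c /hnorm RRe_real ?normr_real // normr_ge0.
apply/eqP/complexI; rewrite -dot_sqr -inner_norm /hnorm rmorphXn /=.
by rewrite RRe_real // normr_real.
Qed.

Lemma normr_hnorm x : `|x| = (hnorm x)%:C%C.
Proof. by rewrite /hnorm RRe_real // normr_real. Qed.

End HilbertNorm.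

Section Tuples.
Variables (R : realType) (H : hilbertType R) (n : nat).
Implicit Types x y z : 'I_n -> H.

Definition tdot x y : R[i] := \sum_i inner H (x i) (y i).

Lemma tdot_bilinear :
  bilinear_for (GRing.Scale.Law.clone _ _ *%R _)
    (GRing.Scale.Law.clone _ _ (@Num.conj R[i] \; *%R) _) tdot.
Proof.
split=> [u a x y|u a x y]; rewrite /tdot /= mulr_sumr -big_split /=.
  by apply: eq_bigr => i _; rewrite dotDl dotZl.
by apply: eq_bigr => i _; rewrite dotDr dotZr.
Qed.

HB.instance Definition _ :=
  bilinear_isBilinear.Build _ _ _ _ _ _ tdot tdot_bilinear.

Lemma tdot_hermitian x y :
  tdot x y = (-1) ^+ false * Num.conj (tdot y x).
Proof.
rewrite expr0 mul1r /tdot rmorph_sum /=; apply: eq_bigr => i _; exact: dotC.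
Qed.

HB.instance Definition _ :=
  isHermitianSesquilinear.Build _ _ _ _ tdot tdot_hermitian.

Lemma tdot_posdef x : x != 0 -> 0 < tdot x x.
Proof.
move=> nz; rewrite lt_def sumr_ge0 ?andbT => [|i _]; last exact: dnorm_ge0.
apply: contra nz; rewrite psumr_eq0 => [/allP h|i _]; last exact: dnorm_ge0.
apply/eqP/funext => i; apply/eqP; rewrite -(dnorm_eq0 (inner H)).
by apply: h; rewrite mem_index_enum.
Qed.

HB.instance Definition _ := isDotProduct.Build _ _ tdot tdot_posdef.

Lemma l2normE x : l2norm x = dotnorm tdot x.
Proof.
rewrite /l2norm /dotnorm Re_sum; congr Num.sqrt; apply: eq_bigr => i _.
by rewrite Re_dot_sqr hnormE.
Qed.

End Tuples.

(** * Orthonormal tuples and the partial isometries between them *)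

Section LinearMaps.
Variables (R : realType) (U V : lmodType R[i]) (T : U -> V).
Hypothesis linT : linear T.

Lemma lin_0 : T 0 = 0.
Proof. by have := linT (-1) 0 0; rewrite scaler0 addr0 scaleN1r addNr. Qed.

Lemma lin_D x y : T (x + y) = T x + T y.
Proof. by have := linT 1 x y; rewrite !scale1r. Qed.

Lemma lin_Z a x : T (a *: x) = a *: T x.
Proof. by have := linT a x 0; rewrite !addr0 lin_0 addr0. Qed.

Lemma lin_N x : T (- x) = - T x.
Proof. by rewrite -scaleN1r lin_Z scaleN1r. Qed.

Lemma lin_B x y : T (x - y) = T x - T y.
Proof. by rewrite lin_D lin_N. Qed.

Lemma lin_sum I (r : seq I) (P : pred I) (E : I -> U) :
  T (\sum_(i <- r | P i) E i) = \sum_(i <- r | P i) T (E i).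
Proof.
elim: r => [|i r IH]; first by rewrite !big_nil lin_0.
by rewrite !big_cons; case: ifP => _; rewrite ?lin_D IH.
Qed.

End LinearMaps.

Section Transfer.
Variable R : realType.
Implicit Types G H L : hilbertType R.

Definition is_orthonormal H n (e : 'I_n -> H) :=
  forall i j, inner H (e i) (e j) = (i == j)%:R.

(** For orthonormal tuples, the partial isometry that sends g i to f i and
    kills the orthogonal complement of the g i; its adjoint is transfer f g,
    and transfer e e is the orthogonal projection onto the span of e. *)
Definition transfer G H n (g : 'I_n -> G) (f : 'I_n -> H) (x : G) : H :=
  \sum_i inner G x (g i) *: f i.

Lemma transfer_linear G H n (g : 'I_n -> G) (f : 'I_n -> H) :
  linear (transfer g f).
Proof.
move=> a x y; rewrite /transfer scaler_sumr -big_split /=.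
by apply: eq_bigr => i _; rewrite dotDl dotZl scalerDl scalerA.
Qed.

Lemma transfer_adj G H n (g : 'I_n -> G) (f : 'I_n -> H) x y :
  inner H (transfer g f x) y = inner G x (transfer f g y).
Proof.
rewrite dot_suml dot_sumr; apply: eq_bigr => i _.
by rewrite dotZl dotZr -dotC mulrC.
Qed.

Lemma transfer_at G H n (g : 'I_n -> G) (f : 'I_n -> H) i :
  is_orthonormal g -> transfer g f (g i) = f i.
Proof.
move=> og; rewrite /transfer (bigD1 i) //= og eqxx scale1r big1 ?addr0 //.
by move=> j ji; rewrite og eq_sym (negbTE ji) scale0r.
Qed.

Lemma transfer_comp G H L n (g : 'I_n -> G) (f : 'I_n -> H) (h : 'I_n -> L) x :
  is_orthonormal f -> transfer f h (transfer g f x) = transfer g h x.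
Proof.
move=> of_; rewrite {2}/transfer (lin_sum (transfer_linear f h)).
apply: eq_bigr => i _.
by rewrite (lin_Z (transfer_linear f h)) transfer_at.
Qed.

Lemma transfer_norm G H n (g : 'I_n -> G) (f : 'I_n -> H) x :
  is_orthonormal g -> is_orthonormal f ->
  dotnorm (inner H) (transfer g f x) <= dotnorm (inner G) x.
Proof.
move=> og of_; set N := dotnorm _ (transfer g f x).
have NP : N = dotnorm (inner G) (transfer g g x).
  by rewrite /N /dotnorm !transfer_adj !transfer_comp.
have : N ^+ 2 <= dotnorm (inner G) x * N.
  by rewrite /N -Re_dot_sqr transfer_adj transfer_comp // -/N NP Re_dot_CS.
have [->|nz] := eqVneq N 0; first by rewrite dotnorm_ge0.
by rewrite expr2 ler_pM2r // lt_def nz dotnorm_ge0.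
Qed.

Lemma transfer_isom G H n (g : 'I_n -> G) (f : 'I_n -> H) x y :
  is_orthonormal f -> transfer g g x = x ->
  inner H (transfer g f x) (transfer g f y) = inner G x y.
Proof. by move=> of_ gx; rewrite transfer_adj transfer_comp // -transfer_adj gx. Qed.

Lemma transfer_proj_inner H n (e : 'I_n -> H) x i :
  is_orthonormal e -> inner H (transfer e e x) (e i) = inner H x (e i).
Proof. by move=> oe; rewrite transfer_adj transfer_at. Qed.

Lemma transfer_fixed_by H n (e : 'I_n -> H)
    (T : H -> H) y : linear T -> (forall i, T (e i) = e i) ->
  T (transfer e e y) = transfer e e y.
Proof.
move=> lT Te; rewrite /transfer (lin_sum lT).
by apply: eq_bigr => i _; rewrite (lin_Z lT) Te.
Qed.

Lemma transfer_in_span H n (e : 'I_n -> H) x :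
  transfer e e x = x -> lin_span (range e) x.
Proof.
move=> <- E [[E0 EZD] sE]; rewrite /transfer.
elim/big_ind: _ => //.
  by move=> a b Ea Eb; rewrite -[a]scale1r; apply: EZD.
move=> i _; rewrite -[_ *: _]addr0; apply: EZD => //.
by apply: sE; exists i.
Qed.

Lemma transfer_fix_subspace H n (e : 'I_n -> H) :
  is_subspace [set x | transfer e e x = x].
Proof.
split=> [|c x y /= ex ey]; first exact: (lin_0 (transfer_linear e e)).
by rewrite (transfer_linear e e) ex ey.
Qed.

Definition tcat H n m (e : 'I_n -> H) (f : 'I_m -> H) : 'I_(n + m) -> H :=
  fun i => match fintype.split i with inl j => e j | inr k => f k end.

Lemma tcat_lshift H n m (e : 'I_n -> H) (f : 'I_m -> H) i :
  tcat e f (lshift m i) = e i.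
Proof. by rewrite /tcat (unsplitK (inl i)). Qed.

Lemma tcat_rshift H n m (e : 'I_n -> H) (f : 'I_m -> H) i :
  tcat e f (rshift n i) = f i.
Proof. by rewrite /tcat (unsplitK (inr i)). Qed.

Lemma tcat_orthonormal H n m (e : 'I_n -> H) (f : 'I_m -> H) :
  is_orthonormal (tcat e f) <->
  [/\ is_orthonormal e, is_orthonormal f &
      forall i j, inner H (e i) (f j) = 0].
Proof.
split=> [oef|[oe of_ ef] i j].
  split=> i j.
  - by have := oef (lshift m i) (lshift m j); rewrite !tcat_lshift eq_lshift.
  - by have := oef (rshift n i) (rshift n j); rewrite !tcat_rshift eq_rshift.
  - by have := oef (lshift m i) (rshift n j);
      rewrite tcat_lshift tcat_rshift eq_lrshift.
case: (split_ordP i) => i' ->; case: (split_ordP j) => j' ->;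
  rewrite ?tcat_lshift ?tcat_rshift ?eq_lshift ?eq_rshift ?eq_lrshift
          ?eq_rlshift //.
by rewrite dotC ef conjC0.
Qed.

Lemma transfer_tcat G H n m (g : 'I_n -> G) (f : 'I_n -> H)
    (g' : 'I_m -> G) (f' : 'I_m -> H) x :
  transfer (tcat g g') (tcat f f') x = transfer g f x + transfer g' f' x.
Proof.
rewrite /transfer big_split_ord /=; congr (_ + _); apply: eq_bigr => i _.
  by rewrite !tcat_lshift.
by rewrite !tcat_rshift.
Qed.

Lemma transfer_orth0 G H n (g : 'I_n -> G) (f : 'I_n -> H) x :
  (forall i, inner G x (g i) = 0) -> transfer g f x = 0.
Proof. by move=> h; rewrite /transfer big1 // => i _; rewrite h scale0r. Qed.

Lemma fixed_tcatl H n m (e : 'I_n -> H) (f : 'I_m -> H) x :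
  is_orthonormal (tcat e f) -> transfer e e x = x ->
  transfer (tcat e f) (tcat e f) x = x.
Proof.
move=> /tcat_orthonormal[oe of_ ef] ex; rewrite transfer_tcat ex.
rewrite (transfer_orth0 (g := f)) ?addr0 // => i.
by rewrite -ex transfer_adj transfer_orth0 ?dot0r // => j; rewrite dotC ef conjC0.
Qed.

(** Gram-Schmidt, one vector: the normalised component of x orthogonal to the
    tuple. *)
Lemma orthonormal_ext1 H n (e : 'I_n -> H) x :
  is_orthonormal e -> transfer e e x <> x ->
  exists2 u : H, is_orthonormal (tcat e (fun _ : 'I_1 => u)) &
    exists c : R[i], c *: u = x - transfer e e x /\
                     u = c^-1 *: (x - transfer e e x).
Proof.
move=> oe ex; set y := x - transfer e e x.
have y0 : dotnorm (inner H) y != 0.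
  by apply/eqP => /dotnorm_eq0/subr0_eq/esym.
set c : R[i] := (dotnorm (inner H) y)%:C%C.
have c0 : c != 0 by rewrite /c -(rmorph0 (real_complex R)) (inj_eq (@complexI _)).
exists (c^-1 *: y); last by exists c; rewrite scalerA divff // scale1r.
apply/tcat_orthonormal; split=> // i j; last first.
  by rewrite dotZr dotC dotBl transfer_proj_inner // subrr conjC0 mulr0.
have cJ : Num.conj c = c by exact: conj_real.
rewrite !ord1 eqxx dotZl dotZr dot_sqr rmorphXn /= -/c fmorphV /= cJ.
by rewrite expr2 mulrA mulrACA mulVf // mulr1.
Qed.

(** Gram-Schmidt.  The last clause says that the new vectors are linear
    combinations of e and s, in the form in which it is used. *)
Lemma orthonormal_ext H n (e : 'I_n -> H) (s : seq H) :
  is_orthonormal e ->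
  exists m (w : 'I_m -> H),
    [/\ is_orthonormal (tcat e w),
        (forall x, x \in s -> transfer (tcat e w) (tcat e w) x = x) &
        (forall T : H -> H, linear T -> (forall i, T (e i) = e i) ->
           (forall x, x \in s -> T x = x) -> forall j, T (w j) = w j)].
Proof.
move=> oe; elim: s => [|x s [m [w [ow fw Tw]]]].
  exists 0%N, (fun i => 0); split=> // [|T _ _ _ []//].
  by apply/tcat_orthonormal; split=> // [[]//|? []//].
have [xw|xw] := pselect (transfer (tcat e w) (tcat e w) x = x).
  exists m, w; split=> // [y|T lT Te Ts].
    by rewrite inE => /orP[/eqP->|/fw].
  by apply: Tw => // y ys; apply: Ts; rewrite inE ys orbT.
have [u ou [c [cu uc]]] := orthonormal_ext1 ow xw.
set u' := fun _ : 'I_1 => u in ou.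
have /tcat_orthonormal[_ ou' wu] := ou.
have /tcat_orthonormal[_ ow' ew] := ow.
exists (m + 1)%N, (tcat w u').
have P y : transfer (tcat e (tcat w u')) (tcat e (tcat w u')) y =
           transfer (tcat (tcat e w) u') (tcat (tcat e w) u') y.
  by rewrite !transfer_tcat addrA.
split=> [|y|T lT Te Ts j].
- apply/tcat_orthonormal; split=> //.
    apply/tcat_orthonormal; split=> // i j.
    by rewrite -(tcat_rshift e w) wu.
  move=> i j; case: (split_ordP j) => j' ->.
    by rewrite tcat_lshift.
  by rewrite tcat_rshift -(tcat_lshift e w) wu.
- rewrite inE P => /orP[/eqP->|/fw yw]; last exact: fixed_tcatl.
  rewrite transfer_tcat.
  have -> : transfer u' u' x = x - transfer (tcat e w) (tcat e w) x.
    rewrite -cu -{1}[x](subrK (transfer (tcat e w) (tcat e w) x)).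
    rewrite (lin_D (transfer_linear u' u')) -cu (lin_Z (transfer_linear u' u')).
    rewrite -[u in transfer _ _ u]/(u' ord0) transfer_at //.
    rewrite (transfer_orth0 (g := u')) ?addr0 // => i.
    by rewrite transfer_adj transfer_orth0 ?dot0r // => k; rewrite dotC wu conjC0.
  by rewrite addrC subrK.
have Tw' : forall i, T (tcat e w i) = tcat e w i.
  move=> i; case: (split_ordP i) => k ->; rewrite ?tcat_lshift ?tcat_rshift //.
  by apply: Tw => // y ys; apply: Ts; rewrite inE ys orbT.
case: (split_ordP j) => k ->; rewrite ?tcat_lshift ?tcat_rshift.
  by rewrite -(tcat_rshift e w) Tw'.
rewrite /u' uc (lin_Z lT) (lin_B lT) Ts ?mem_head //.
rewrite {1}/transfer (lin_sum lT); congr (_ *: (_ - _)).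
by apply: eq_bigr => i _; rewrite (lin_Z lT) Tw'.
Qed.

Lemma is_orthonormal0 H (e : 'I_0 -> H) : is_orthonormal e.
Proof. by case. Qed.

Lemma transfer_tcat0 H m (w : 'I_m -> H) x :
  transfer (tcat (fun _ : 'I_0 => 0) w) (tcat (fun _ : 'I_0 => 0) w) x =
  transfer w w x.
Proof. by rewrite transfer_tcat {1}/transfer big_ord0 add0r. Qed.

Lemma orthonormal_span H (s : seq H) :
  exists m (w : 'I_m -> H),
    [/\ is_orthonormal w,
        (forall x, x \in s -> transfer w w x = x) &
        (forall T : H -> H, linear T ->
           (forall x, x \in s -> T x = x) -> forall j, T (w j) = w j)].
Proof.
have [m [w [ow fw Tw]]] := orthonormal_ext s (@is_orthonormal0 H (fun=> 0)).
exists m, w; split=> [|x /fw|T lT Ts j].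
- by have /tcat_orthonormal[] := ow.
- by rewrite transfer_tcat0.
- by apply: Tw => // -[].
Qed.

Lemma finite_dim_orthonormal H (E : set H) : finite_dim E ->
  exists n (e : 'I_n -> H), is_orthonormal e /\
    forall x, E x -> transfer e e x = x.
Proof.
move=> [n [v Ev]].
have [m [w [ow fw _]]] := orthonormal_span [seq v i | i : 'I_n].
exists m, w; split=> // x /Ev /(_ [set x | transfer w w x = x]); apply.
split; first exact: transfer_fix_subspace.
by move=> _ [i _ <-]; apply: fw; rewrite map_f // mem_enum.
Qed.

Lemma orthonormal_finite_dim H n (e : 'I_n -> H) (E : set H) :
  (forall x, E x -> transfer e e x = x) -> finite_dim E.
Proof. by move=> h; exists n, e => x /h /transfer_in_span. Qed.

Lemma infinite_dim_orthonormal H n (e : 'I_n -> H) m :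
  ~ finite_dim [set: H] -> is_orthonormal e ->
  exists f : 'I_m -> H, is_orthonormal (tcat e f).
Proof.
move=> infH oe; elim: m => [|m [f of_]].
  exists (fun=> 0); apply/tcat_orthonormal.
  by split=> // [[]//|? []//].
have [x ex] : exists x, transfer (tcat e f) (tcat e f) x <> x.
  apply: contrapT => /forallNP h; apply: infH.
  apply: (orthonormal_finite_dim (e := tcat e f)) => x _.
  by apply: contrapT; apply: h.
have [u ou _] := orthonormal_ext1 of_ ex.
have /tcat_orthonormal[_ ou' fu] := ou.
have /tcat_orthonormal[_ of' ef] := of_.
have -> : m.+1 = (m + 1)%N by rewrite addn1.
exists (tcat f (fun _ : 'I_1 => u)); apply/tcat_orthonormal; split=> //.
  by apply/tcat_orthonormal; split=> // i j; rewrite -(tcat_rshift e f) fu.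
move=> i j; case: (split_ordP j) => j' ->; rewrite ?tcat_lshift ?tcat_rshift //.
by rewrite -(tcat_lshift e f) fu.
Qed.

End Transfer.

(** * Operator norms and representations *)

Notation nrm := (dotnorm (inner _)).
Notation tnrm := (dotnorm (@tdot _ _ _)).

Lemma nrm_small (R : realType) (H : hilbertType R) (x y : H) :
  (forall eps : R, 0 < eps -> nrm (x - y) <= eps) -> x = y.
Proof.
move=> h; apply: subr0_eq; apply: (@dotnorm_eq0 _ _ (inner H)); apply/eqP.
rewrite eq_le dotnorm_ge0 andbT; apply/ler_addgt0Pr => eps e0.
by rewrite add0r; apply: h.
Qed.

Section OperatorNorm.
Variables (R : realType) (U : lmodType R[i]) (f : {dot U for @Num.conj R[i]}).
Variable T : U -> U.
Hypothesis linT : linear T.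
Let N := [set dotnorm f (T x) | x in [set x | dotnorm f x <= 1]].

Lemma unit_ball_sup_ge0 (M : R) :
  (forall x, dotnorm f (T x) <= M * dotnorm f x) -> 0 <= sup N.
Proof.
move=> hM; apply: sup_upper_bound; last first.
  by exists 0; rewrite /= ?dotnorm0 // (lin_0 linT) dotnorm0.
split; first by exists (dotnorm f (T 0)), 0 => //=; rewrite dotnorm0.
exists `|M| => _ [x /= x1 <-]; apply: le_trans (hM x) _.
rewrite -[leRHS]mulr1; apply: le_trans (ler_norm _) _.
by rewrite normrM ler_wpM2l // ger0_norm ?dotnorm_ge0.
Qed.

Lemma le_unit_ball_sup (M : R) x :
  (forall x, dotnorm f (T x) <= M * dotnorm f x) ->
  dotnorm f (T x) <= sup N * dotnorm f x.
Proof.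
move=> hM; have [x0|nz] := eqVneq (dotnorm f x) 0.
  by rewrite (dotnorm_eq0 x0) (lin_0 linT) !dotnorm0 mulr0.
have xp : 0 < dotnorm f x by rewrite lt_def nz dotnorm_ge0.
set c : R[i] := ((dotnorm f x)^-1)%:C%C.
have cc : cabs c = (dotnorm f x)^-1.
  by rewrite /cabs ger0_norm //= ler0c invr_ge0 dotnorm_ge0.
rewrite -ler_pdivrMr // mulrC -cc -dotnormZ -(lin_Z linT).
apply: sup_upper_bound; last first.
  by exists (c *: x) => //=; rewrite dotnormZ cc mulVf.
split; first by exists (dotnorm f (T 0)), 0 => //=; rewrite dotnorm0.
exists `|M| => _ [y /= y1 <-]; apply: le_trans (hM y) _.
rewrite -[leRHS]mulr1; apply: le_trans (ler_norm _) _.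
by rewrite normrM ler_wpM2l // ger0_norm ?dotnorm_ge0.
Qed.

Lemma unit_ball_sup_le (M : R) : 0 <= M ->
  (forall x, dotnorm f (T x) <= M * dotnorm f x) -> sup N <= M.
Proof.
move=> M0 hM; apply: ge_sup.
  by exists (dotnorm f (T 0)), 0 => //=; rewrite dotnorm0.
move=> _ [y /= y1 <-]; apply: le_trans (hM y) _.
by rewrite -[leRHS]mulr1 ler_wpM2l.
Qed.

End OperatorNorm.

Lemma tnrm_sqr (R : realType) (H : hilbertType R) n (x : 'I_n -> H) :
  tnrm x ^+ 2 = \sum_i nrm (x i) ^+ 2.
Proof.
rewrite -Re_dot_sqr /tdot Re_sum; apply: eq_bigr => i _; exact: Re_dot_sqr.
Qed.

Lemma tnrm1 (R : realType) (H : hilbertType R) (x : 'I_1 -> H) :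
  tnrm x = nrm (x ord0).
Proof.
apply/eqP; rewrite -(@eqrXn2 _ 2) ?dotnorm_ge0 //.
by rewrite tnrm_sqr big_ord1.
Qed.

Section TupleNorm.
Variables (R : realType) (H : hilbertType R) (n : nat).
Implicit Types x y : 'I_n -> H.

Lemma tnrm_mono m (G : hilbertType R) x (y : 'I_m -> G) :
  \sum_i nrm (x i) ^+ 2 <= \sum_i nrm (y i) ^+ 2 -> tnrm x <= tnrm y.
Proof.
by move=> h; rewrite -(@ler_pXn2r _ 2) ?nnegrE ?dotnorm_ge0 // !tnrm_sqr.
Qed.

Lemma tnrm_le (G : hilbertType R) x (y : 'I_n -> G) :
  (forall i, nrm (x i) <= nrm (y i)) -> tnrm x <= tnrm y.
Proof.
move=> h; apply: tnrm_mono; apply: ler_sum => i _.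
by rewrite ler_pXn2r ?nnegrE ?dotnorm_ge0.
Qed.

Lemma nrm_le_tnrm x i : nrm (x i) <= tnrm x.
Proof.
rewrite -(@ler_pXn2r _ 2) ?nnegrE ?dotnorm_ge0 // tnrm_sqr (bigD1 i) //=.
by rewrite lerDl sumr_ge0 // => j _; rewrite sqr_ge0.
Qed.

Lemma tnrm_le_sum x : tnrm x <= \sum_i nrm (x i).
Proof.
have s0 : 0 <= \sum_i nrm (x i) by apply: sumr_ge0 => i _; apply: dotnorm_ge0.
rewrite -(@ler_pXn2r _ 2) ?nnegrE ?dotnorm_ge0 // tnrm_sqr.
rewrite [leRHS]expr2 mulr_suml; apply: ler_sum => i _.
rewrite expr2 ler_wpM2l ?dotnorm_ge0 // (bigD1 i) //= lerDl.
by apply: sumr_ge0 => j _; apply: dotnorm_ge0.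
Qed.

End TupleNorm.

Section Matrices.
Variables (R : realType) (H : hilbertType R).
Implicit Types (T : H -> H).

Lemma bounded_opsE T :
  bounded_ops T <->
  linear T /\ exists M : R, forall x, nrm (T x) <= M * nrm x.
Proof.
split=> [[lT [M hM]]|[lT [M hM]]]; split=> //; exists M => x.
  by rewrite -!hnormE.
by rewrite !hnormE.
Qed.

Lemma le_opnorm T x : bounded_ops T -> nrm (T x) <= opnorm T * nrm x.
Proof.
move=> /bounded_opsE[lT [M hM]].
rewrite /opnorm (_ : @hnorm R H = nrm) ?(le_unit_ball_sup lT x hM) //.
by apply: funext => y; rewrite hnormE.
Qed.

Lemma bounded_ops0 : bounded_ops (0 : H -> H).
Proof.
apply/bounded_opsE; split=> [a x y|].
  by rewrite /GRing.zero /= scaler0 addr0.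
by exists 0 => x; rewrite mul0r dotnorm0.
Qed.

Section Mx.
Variables (n : nat) (a : 'M[H -> H]_n).
Hypothesis ba : forall i j, bounded_ops (a i j).

Lemma mxop_linear : linear (mxop a).
Proof.
move=> c x y; apply/funext => i; rewrite /mxop /=.
change (\sum_j a i j (c *: x j + y j) =
  c *: (\sum_j a i j (x j)) + \sum_j a i j (y j)).
rewrite scaler_sumr -big_split /=.
by apply: eq_bigr => j _; have [lin _] := ba i j; rewrite (lin c).
Qed.

Lemma mxop_bounded : exists M : R, forall x, tnrm (mxop a x) <= M * tnrm x.
Proof.
have /choice[M hM] : forall ij : 'I_n * 'I_n,
    exists M : R, 0 <= M /\ forall x, nrm (a ij.1 ij.2 x) <= M * nrm x.
  move=> [i j] /=; have /bounded_opsE[_ [M hM]] := ba i j.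
  exists `|M|; split=> // x; apply: le_trans (hM x) _.
  by rewrite ler_wpM2r ?dotnorm_ge0 ?ler_norm.
exists (\sum_i \sum_j M (i, j)) => x.
apply: le_trans (tnrm_le_sum _) _; rewrite mulr_suml; apply: ler_sum => i _.
apply: le_trans (dotnorm_sum _ _ _ _) _; rewrite mulr_suml; apply: ler_sum => j _.
have [M0 hx] := hM (i, j); apply: le_trans (hx (x j)) _.
by rewrite ler_wpM2l ?nrm_le_tnrm.
Qed.

Lemma mxopnormE :
  mxopnorm a = sup [set tnrm (mxop a x) | x in [set x | tnrm x <= 1]].
Proof.
rewrite /mxopnorm (_ : @l2norm R H n = tnrm) //.
by apply: funext => y; rewrite l2normE.
Qed.

Lemma le_mxopnorm x : tnrm (mxop a x) <= mxopnorm a * tnrm x.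
Proof.
have [M hM] := mxop_bounded.
by rewrite mxopnormE (le_unit_ball_sup mxop_linear x hM).
Qed.

Lemma mxopnorm_ge0 : 0 <= mxopnorm a.
Proof.
have [M hM] := mxop_bounded.
by rewrite mxopnormE (unit_ball_sup_ge0 mxop_linear hM).
Qed.

Lemma mxopnorm_le (M : R) : 0 <= M ->
  (forall x, tnrm (mxop a x) <= M * tnrm x) -> mxopnorm a <= M.
Proof. by move=> M0 hM; rewrite mxopnormE; apply: unit_ball_sup_le. Qed.

End Mx.

(** Representations are contractive on matrices; on a single element this reads
    as a bound by its norm as a 1 x 1 matrix. *)
Definition norm1 T : R := mxopnorm (\matrix_(i < 1, j < 1) T).

Lemma norm1_ge0 T : bounded_ops T -> 0 <= norm1 T.
Proof. by move=> bT; apply: mxopnorm_ge0 => i j; rewrite mxE. Qed.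

End Matrices.

Section Algebra.
Variables (R : realType) (K : hilbertType R) (A : set (K -> K)).
Hypothesis hA : is_operator_algebra A.

Lemma alg_bounded a : A a -> bounded_ops a.
Proof. by case: hA => h _ _ _ _; apply: h. Qed.
Lemma alg0 : A 0.
Proof. by case: hA. Qed.
Lemma alg_ZD c a b : A a -> A b -> A (c *: a + b).
Proof. by case: hA => _ _ h _ _; apply: h. Qed.
Lemma algM a b : A a -> A b -> A (a \o b).
Proof. by case: hA => _ _ _ h _; apply: h. Qed.
Lemma algZ c a : A a -> A (c *: a).
Proof. by move=> Aa; rewrite -[_ *: _]addr0; apply: alg_ZD => //; apply: alg0. Qed.
Lemma algD a b : A a -> A b -> A (a + b).
Proof. by move=> Aa Ab; rewrite -[a]scale1r; apply: alg_ZD. Qed.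
Lemma alg_sum I (r : seq I) (P : pred I) (F : I -> (K -> K)) :
  (forall i, P i -> A (F i)) -> A (\sum_(i <- r | P i) F i).
Proof. by move=> h; elim/big_ind: _ => //; [apply: alg0|apply: algD]. Qed.

Section Representation.
Variables (H : hilbertType R) (pi : (K -> K) -> (H -> H)).

Lemma representation_intro :
  (forall a, A a -> linear (pi a)) ->
  (forall (c : R[i]) a b, A a -> A b -> pi (c *: a + b) = c *: pi a + pi b) ->
  (forall a b, A a -> A b -> pi (a \o b) = pi a \o pi b) ->
  (forall n (a : 'M[K -> K]_n), (forall i j, A (a i j)) -> forall x,
     tnrm (mxop (map_mx pi a) x) <= mxopnorm a * tnrm x) ->
  is_representation A pi.
Proof.
move=> lpi piD piM cc; split=> // [a Aa|n a Aa].
  apply/bounded_opsE; split; first exact: lpi.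
  exists (norm1 a) => x.
  have /cc/(_ (fun=> x)) : forall i j, A ((\matrix_(i < 1, j < 1) a) i j).
    by move=> i j; rewrite mxE.
  by rewrite !tnrm1 /mxop big_ord1 !mxE.
by apply: mxopnorm_le; [apply: mxopnorm_ge0 => i j; apply: alg_bounded|apply: cc].
Qed.

Hypothesis rpi : is_representation A pi.

Lemma rep_bounded a : A a -> bounded_ops (pi a).
Proof. by case: rpi => h _ _ _; apply: h. Qed.

Lemma rep_linear a : A a -> linear (pi a).
Proof. by case/rep_bounded. Qed.

Lemma rep_ZD c a b : A a -> A b -> pi (c *: a + b) = c *: pi a + pi b.
Proof. by case: rpi => _ h _ _; apply: h. Qed.

Lemma repM a b : A a -> A b -> pi (a \o b) = pi a \o pi b.
Proof. by case: rpi => _ _ h _; apply: h. Qed.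

Lemma rep0 : pi 0 = 0.
Proof.
have := rep_ZD (-1) (alg0) (alg0).
by rewrite scaler0 addr0 scaleN1r addNr.
Qed.

Lemma repD a b : A a -> A b -> pi (a + b) = pi a + pi b.
Proof. by move=> Aa Ab; have := rep_ZD 1 Aa Ab; rewrite !scale1r. Qed.

Lemma repZ c a : A a -> pi (c *: a) = c *: pi a.
Proof. by move=> Aa; have := rep_ZD c Aa alg0; rewrite rep0 !addr0. Qed.

Lemma rep_sum I (r : seq I) (P : pred I) (F : I -> (K -> K)) :
  (forall i, P i -> A (F i)) ->
  pi (\sum_(i <- r | P i) F i) = \sum_(i <- r | P i) pi (F i).
Proof.
move=> h; elim: r => [|i r IH]; first by rewrite !big_nil rep0.
rewrite !big_cons; case: ifP => Pi //.
by rewrite repD ?IH; [|exact: h|exact: alg_sum].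
Qed.

Lemma rep_contractive n (a : 'M[K -> K]_n) : (forall i j, A (a i j)) ->
  forall x, tnrm (mxop (map_mx pi a) x) <= mxopnorm a * tnrm x.
Proof.
move=> Aa x; case: rpi => bpi _ _ cc.
have b i j : bounded_ops (map_mx pi a i j) by rewrite mxE; apply: bpi.
apply: le_trans (le_mxopnorm b x) _.
by rewrite ler_wpM2r ?dotnorm_ge0 ?cc.
Qed.

Lemma rep_norm a x : A a -> nrm (pi a x) <= norm1 a * nrm x.
Proof.
move=> Aa.
have /rep_contractive/(_ (fun=> x)) :
    forall i j, A ((\matrix_(i < 1, j < 1) a) i j).
  by move=> i j; rewrite mxE.
by rewrite !tnrm1 /mxop big_ord1 !mxE.
Qed.

End Representation.

Definition transfer_rep (G H : hilbertType R) n (g : 'I_n -> G) (f : 'I_n -> H)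
    (sigma : (K -> K) -> (G -> G)) : (K -> K) -> (H -> H) :=
  fun a x => transfer g f (sigma a (transfer f g x)).

(** Multiplicativity holds because the values of sigma lie in the initial space
    of the partial isometry. *)
Lemma transfer_rep_representation (G H : hilbertType R) n (g : 'I_n -> G)
    (f : 'I_n -> H) (sigma : (K -> K) -> (G -> G)) :
  is_orthonormal g -> is_orthonormal f -> is_representation A sigma ->
  (forall a x, A a -> transfer g g (sigma a x) = sigma a x) ->
  is_representation A (transfer_rep g f sigma).
Proof.
move=> og of_ rs gs; apply: representation_intro.
- move=> a Aa c x y; rewrite /transfer_rep (transfer_linear f g).
  by rewrite (rep_linear rs Aa c) (transfer_linear g f).
- move=> c a b Aa Ab; apply: funext => x; rewrite /transfer_rep (rep_ZD rs) //.
  exact: (transfer_linear g f).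
- move=> a b Aa Ab; apply: funext => x; rewrite /transfer_rep (repM rs) //=.
  by rewrite transfer_comp // gs.
move=> m a Aa x.
have -> : mxop (map_mx (transfer_rep g f sigma) a) x =
    fun i => transfer g f (mxop (map_mx sigma a) (fun j => transfer f g (x j)) i).
  apply: funext => i; rewrite /mxop (lin_sum (transfer_linear g f)).
  by apply: eq_bigr => j _; rewrite !mxE.
apply: (@le_trans _ _ (tnrm (mxop (map_mx sigma a) (fun j => transfer f g (x j))))).
  by apply: tnrm_le => i; apply: transfer_norm.
apply: le_trans (rep_contractive rs Aa _) _.
apply: ler_wpM2l; first by apply: mxopnorm_ge0 => i j; apply: alg_bounded.
by apply: tnrm_le => i; apply: transfer_norm.
Qed.

(** The span of e contains the carrier of pi, the essential space of the
    C*-algebra generated by pi(A). *)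
Definition carried (H : hilbertType R) n (e : 'I_n -> H)
    (pi : (K -> K) -> (H -> H)) :=
  forall a x, A a -> transfer e e (pi a x) = pi a x /\
                     pi a (transfer e e x) = pi a x.

Lemma transfer_rep_carried (G H : hilbertType R) n (g : 'I_n -> G)
    (f : 'I_n -> H) (sigma : (K -> K) -> (G -> G)) :
  is_orthonormal f -> carried f (transfer_rep g f sigma).
Proof. by move=> of_ a x Aa; rewrite /transfer_rep !transfer_comp. Qed.

Lemma zero_representation (H : hilbertType R) :
  is_representation A (fun _ (_ : H) => 0).
Proof.
apply: representation_intro.
- by move=> a _ c x y; rewrite scaler0 addr0.
- by move=> c a b _ _; apply: funext => x; rewrite [RHS]/GRing.add /= scaler0 addr0.
- by [].
move=> n a Aa x.
have -> : mxop (map_mx (fun _ (_ : H) => 0) a) x = 0.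
  by apply: funext => i; rewrite /mxop big1 // => j _; rewrite mxE.
rewrite dotnorm0 mulr_ge0 ?dotnorm_ge0 //.
by apply: mxopnorm_ge0 => i j; apply: alg_bounded.
Qed.

Lemma zero_carried (H : hilbertType R) n (e : 'I_n -> H) :
  carried e (fun _ _ => 0).
Proof. by move=> a x _; rewrite (lin_0 (transfer_linear e e)). Qed.

(** Contractivity of an orthogonal sum is the Pythagorean theorem, applied to
    both the arguments and the values. *)
Lemma sum_representation (H : hilbertType R) n m (e : 'I_n -> H)
    (f : 'I_m -> H) pi rho :
  is_orthonormal (tcat e f) ->
  is_representation A pi -> carried e pi ->
  is_representation A rho -> carried f rho ->
  is_representation A (fun a => pi a + rho a) /\
  carried (tcat e f) (fun a => pi a + rho a).
Proof.
move=> oef rp ce rr cf.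
have oe : is_orthonormal e by case/tcat_orthonormal: oef.
have of_ : is_orthonormal f by case/tcat_orthonormal: oef.
have ef i j : inner H (e i) (f j) = 0 by case/tcat_orthonormal: oef.
have fe i j : inner H (f i) (e j) = 0 by rewrite dotC ef conjC0.
have PQ x : transfer e e (transfer f f x) = 0.
  apply: transfer_orth0 => i; rewrite transfer_adj transfer_orth0 ?dot0r //.
have QP x : transfer f f (transfer e e x) = 0.
  apply: transfer_orth0 => i; rewrite transfer_adj transfer_orth0 ?dot0r //.
have pyth x y : nrm (transfer e e x + transfer f f y) ^+ 2 =
    nrm (transfer e e x) ^+ 2 + nrm (transfer f f y) ^+ 2.
  by rewrite dotnorm_sqrD transfer_adj PQ dot0r mulr0 addr0.
have lp a (Aa : A a) := rep_linear rp Aa.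
have lr a (Aa : A a) := rep_linear rr Aa.
split; last first.
  move=> a x Aa; have [p1 p2] := ce a x Aa; have [r1 r2] := cf a x Aa.
  have [_ p3] := ce a (transfer f f x) Aa; have [_ r3] := cf a (transfer e e x) Aa.
  rewrite -[(_ + _) x]/(pi a x + rho a x) -[(_ + _) (transfer _ _ _)]/(_ + _).
  have z1 : transfer e e (rho a x) = 0 by rewrite -r1 PQ.
  have z2 : transfer f f (pi a x) = 0 by rewrite -p1 QP.
  rewrite !transfer_tcat (lin_D (transfer_linear e e)).
  rewrite (lin_D (transfer_linear f f)) p1 r1 z1 z2 addr0 add0r; split=> //.
  rewrite (lin_D (lp a Aa)) (lin_D (lr a Aa)) p2 r2.
  by rewrite -p3 -r3 PQ QP (lin_0 (lp a Aa)) (lin_0 (lr a Aa)) addr0 add0r.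
apply: representation_intro.
- move=> a Aa c x y; rewrite -[LHS]/(pi a _ + rho a _) (lp a Aa c) (lr a Aa c).
  by rewrite addrACA -scalerDr.
- move=> c a b Aa Ab; rewrite (rep_ZD rp) // (rep_ZD rr) //.
  by rewrite addrACA -scalerDr.
- move=> a b Aa Ab; rewrite (repM rp) // (repM rr) //; apply: funext => x.
  rewrite -[LHS]/(pi a (pi b x) + rho a (rho b x)).
  rewrite -[RHS]/(pi a (pi b x + rho b x) + rho a (pi b x + rho b x)).
  rewrite (lin_D (lp a Aa)) (lin_D (lr a Aa)).
  have [p1 _] := ce b x Ab; have [r1 _] := cf b x Ab.
  have [_ p2] := ce a (rho b x) Aa; have [_ r2] := cf a (pi b x) Aa.
  rewrite -p2 -r2 -{2}r1 -{3}p1 PQ QP (lin_0 (lp a Aa)) (lin_0 (lr a Aa)).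
  by rewrite addr0 add0r.
move=> k a Aa x.
set X := fun i => transfer e e (x i); set Y := fun i => transfer f f (x i).
set p := mxop (map_mx pi a) X; set r := mxop (map_mx rho a) Y.
have pP i : transfer e e (p i) = p i.
  rewrite /p /mxop (lin_sum (transfer_linear e e)); apply: eq_bigr => j _.
  by rewrite mxE; have [] := ce (a i j) (X j) (Aa i j).
have rP i : transfer f f (r i) = r i.
  rewrite /r /mxop (lin_sum (transfer_linear f f)); apply: eq_bigr => j _.
  by rewrite mxE; have [] := cf (a i j) (Y j) (Aa i j).
have xE i : mxop (map_mx (fun a => pi a + rho a) a) x i = p i + r i.
  rewrite /p /r /mxop -big_split; apply: eq_bigr => j _; rewrite !mxE.
  have [_ p2] := ce (a i j) (x j) (Aa i j).
  have [_ r2] := cf (a i j) (x j) (Aa i j).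
  by rewrite /X /Y /= p2 r2.
have M0 : 0 <= mxopnorm a by apply: mxopnorm_ge0 => i j; apply: alg_bounded.
rewrite -(@ler_pXn2r _ 2) ?nnegrE ?mulr_ge0 ?dotnorm_ge0 //.
have -> : tnrm (mxop (map_mx (fun a => pi a + rho a) a) x) ^+ 2 =
          tnrm p ^+ 2 + tnrm r ^+ 2.
  rewrite !tnrm_sqr -big_split /=; apply: eq_bigr => i _.
  by rewrite xE -pP -rP pyth pP rP.
have hXY : tnrm X ^+ 2 + tnrm Y ^+ 2 <= tnrm x ^+ 2.
  rewrite !tnrm_sqr -big_split /=; apply: ler_sum => i _; rewrite /X /Y -pyth.
  rewrite -transfer_tcat ler_pXn2r ?nnegrE ?dotnorm_ge0 //.
  exact: transfer_norm.
rewrite exprMn; apply: le_trans (ler_wpM2l (sqr_ge0 _) hXY).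
rewrite mulrDr -!exprMn; apply: lerD;
  rewrite ler_pXn2r ?nnegrE ?mulr_ge0 ?dotnorm_ge0 //; exact: rep_contractive.
Qed.

End Algebra.

Section FiniteCarrier.
Variables (R : realType) (H : hilbertType R) (n : nat) (e : 'I_n -> H).
Hypothesis oe : is_orthonormal e.

Lemma adjoint_uniq (T S : H -> H) : is_adjoint T S -> adjoint T = S.
Proof.
move=> hS; apply: xget_unique => // S' hS'; apply: funext => y.
apply: (@dot_ext _ _ (inner H)) => z.
by rewrite dotC [RHS]dotC -hS -hS'.
Qed.

Lemma adjoint_bounded (T S : H -> H) :
  bounded_ops T -> is_adjoint T S -> bounded_ops S.
Proof.
move=> bT hS; apply/bounded_opsE; split=> [c x y|].
  apply: (@dot_ext _ _ (inner H)) => z.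
  by rewrite dotC [RHS]dotC -hS !dotDr !dotZr -!hS.
exists `|opnorm T| => y; apply: dotnorm_le_dot => [|z].
  by rewrite mulr_ge0 ?dotnorm_ge0.
rewrite dotC cabsJ -hS; apply: le_trans (dot_CS _ _ _) _.
rewrite mulrAC ler_wpM2r ?dotnorm_ge0 //; apply: le_trans (le_opnorm z bT) _.
by rewrite ler_wpM2r ?dotnorm_ge0 ?ler_norm.
Qed.

(** The operators living on the span of e form a C*-algebra, because the two
    identities that define them survive norm limits. *)
Lemma carrier_Cstar : is_Cstar_algebra
  [set T : H -> H | bounded_ops T /\
     forall x, transfer e e (T x) = T x /\ T (transfer e e x) = T x].
Proof.
set P := transfer e e; have lP : linear P := transfer_linear e e.
have nP x : nrm (P x) <= nrm x by apply: transfer_norm.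
have zeroP : bounded_ops (0 : H -> H) /\
    forall x, P ((0 : H -> H) x) = (0 : H -> H) x /\
              (0 : H -> H) (P x) = (0 : H -> H) x.
  by split=> [|x]; [exact: bounded_ops0|rewrite (lin_0 lP)].
split; last first.
  move=> T [bT hT]; have [[S hS]|noS] := pselect (exists S, is_adjoint T S).
    rewrite (adjoint_uniq hS); split; first exact: adjoint_bounded hS.
    move=> x; split; apply: (@dot_ext _ _ (inner H)) => z;
      rewrite dotC [RHS]dotC; congr Num.conj.
      by rewrite -transfer_adj -!hS; have [_ ->] := hT z.
    rewrite -[LHS]hS -[RHS]hS -[LHS](transfer_adj e e).
    by have [h _] := hT z; rewrite -[in RHS]h.
  rewrite /adjoint xgetPN // => S hS; apply: noS; by exists S.
split=> //.
- by move=> T [].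
- move=> c S T [bS hS] [bT hT]; split.
    have /bounded_opsE[lS [M hM]] := bS; have /bounded_opsE[lT [N hN]] := bT.
    apply/bounded_opsE; split=> [a x y|].
      rewrite -[LHS]/(c *: S (a *: x + y) + T (a *: x + y)) lS lT.
      rewrite -[RHS]/(a *: (c *: S x + T x) + (c *: S y + T y)).
      by rewrite !scalerDr addrACA !scalerA mulrC.
    exists (cabs c * M + N) => x.
    apply: le_trans (dotnormD _ _ _) _; rewrite dotnormZ mulrDl.
    by rewrite lerD // -mulrA ler_wpM2l ?cabs_ge0.
  move=> x; have [h1 h2] := hS x; have [h3 h4] := hT x.
  rewrite -[(_ + _) x]/(c *: S x + T x) lP h1 h3; split=> //.
  by rewrite -[LHS]/(c *: S (P x) + T (P x)) h2 h4.
- move=> S T [bS hS] [bT hT]; split.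
    have /bounded_opsE[lS [M hM]] := bS; have /bounded_opsE[lT [N hN]] := bT.
    apply/bounded_opsE; split=> [a x y|]; first by rewrite /= lT lS.
    exists (`|M| * N) => x /=; apply: le_trans (hM _) _.
    rewrite -mulrA; apply: (@le_trans _ _ (`|M| * nrm (T x))).
      by rewrite ler_wpM2r ?dotnorm_ge0 ?ler_norm.
    by rewrite ler_wpM2l.
  by move=> x /=; have [h1 _] := hS (T x); have [_ ->] := hT x.
move=> T bT lim; split=> //; have /bounded_opsE[lT _] := bT.
have app (eps : R) x : 0 < eps ->
    exists2 S, (forall x, P (S x) = S x /\ S (P x) = S x) &
      nrm (T x - S x) <= eps /\ nrm (T (P x) - S (P x)) <= eps.
  move=> e0; set d := eps / (nrm x + 1).
  have n1 : 0 < nrm x + 1 by rewrite ltr_wpDl ?dotnorm_ge0.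
  have [S [bS hS] dS] := lim d (divr_gt0 e0 n1).
  exists S => //.
  have bTS : bounded_ops (T - S).
    have /bounded_opsE[lS [M hM]] := bS; have /bounded_opsE[_ [N hN]] := bT.
    apply/bounded_opsE; split=> [a u v|].
      rewrite -[LHS]/(T (a *: u + v) - S (a *: u + v)) lS lT.
      rewrite -[RHS]/(a *: (T u - S u) + (T v - S v)).
      by rewrite opprD addrACA scalerBr.
    exists (N + M) => u; apply: le_trans (dotnormD _ _ _) _.
    by rewrite dotnormN mulrDl lerD.
  have key y : nrm y <= nrm x -> nrm (T y - S y) <= eps.
    move=> yx; apply: le_trans (le_opnorm y bTS) _.
    apply: (@le_trans _ _ (d * nrm y)).
      by rewrite ler_wpM2r ?dotnorm_ge0 // ltW.
    rewrite /d mulrAC ler_pdivrMr // ler_wpM2l ?ltW //.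
    by apply: le_lt_trans yx _; rewrite ltrDl.
  by split; apply: key.
move=> x; split; apply: nrm_small => eps e0; have e2 : 0 < eps / 2 by rewrite divr_gt0.
  have [S hS [h1 _]] := app (eps / 2) x e2.
  rewrite (le_trans (dotnorm_distD _ (S x) _ _)) //.
  have -> : eps = eps / 2 + eps / 2 by lra.
  apply: lerD; last by rewrite dotnormB.
  by have [<- _] := hS x; rewrite -(lin_B lP); apply: le_trans (nP _) h1.
have [S hS [h1 h2]] := app (eps / 2) x e2.
rewrite (le_trans (dotnorm_distD _ (S x) _ _)) //.
have -> : eps = eps / 2 + eps / 2 by lra.
by apply: lerD; [have [_ <-] := hS x|rewrite dotnormB].
Qed.

Lemma carrier_closed : closure [set x | transfer e e x = x] `<=`
  [set x | transfer e e x = x].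
Proof.
move=> x cx /=; set P := transfer e e.
have lP : linear P := transfer_linear e e.
apply: nrm_small => eps e0.
have e2 : 0 < (eps / 2)%:C%C :> R[i] by rewrite -(rmorph0 (real_complex R)) ltcR divr_gt0.
have [y [/= Py xy]] := cx _ (nbhsx_ballx x _ e2).
move: xy; rewrite -ball_normE /= normr_hnorm ltcR hnormE => /ltW xy.
rewrite (le_trans (dotnorm_distD _ y _ _)) //.
have -> : eps = eps / 2 + eps / 2 by lra.
apply: lerD; last by rewrite dotnormB.
rewrite -Py -/P -(lin_B lP); apply: le_trans xy; exact: transfer_norm.
Qed.

(** The C*-algebra generated by the range of pi stays inside the C*-algebra of
    the operators living on the span of e. *)
Lemma carried_finite_dim (K : hilbertType R) (A : set (K -> K)) pi :
  is_representation A pi -> carried A e pi -> finite_dim_representation A pi.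
Proof.
move=> rpi cpi; split=> //; apply: (orthonormal_finite_dim (e := e)) => x cx.
apply: carrier_closed; move: x cx; apply: closure_subset => x.
apply; split; first exact: transfer_fix_subspace.
move=> _ [T CT [y ->]] /=.
have [_ /(_ y)[]//] : [set T : H -> H | bounded_ops T /\
     forall x, transfer e e (T x) = T x /\ T (transfer e e x) = T x] T.
apply: CT; split; first exact: carrier_Cstar.
move=> _ [a Aa <-]; split; first exact: rep_bounded Aa.
by move=> z; apply: cpi.
Qed.

End FiniteCarrier.

(** * Real part inequalities pass to all representations *)

Lemma expr_small (R : realType) (q eps : R) :
  0 <= q < 1 -> 0 < eps -> exists N, q ^+ N < eps.
Proof.
move=> /andP[q0 q1] e0.
have /cvgrPdist_lt/(_ _ e0) : (fun n => q ^+ n) @ \oo --> (0 : R).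
  by apply: cvg_expr; rewrite ger0_norm.
move=> [N _ /(_ N (leqnn N))]; rewrite sub0r normrN ger0_norm ?exprn_ge0 //.
by exists N.
Qed.

Lemma le_of_geometric (R : realType) (q a b c : R) :
  0 <= q < 1 -> (forall N, a <= b + q ^+ N * c) -> a <= b.
Proof.
move=> q01 h; rewrite leNgt; apply/negP => ab.
have cp : 0 < `|c| + 1 by rewrite ltr_wpDl.
have e0 : 0 < (a - b) / (`|c| + 1) by rewrite divr_gt0 ?subr_gt0.
have [N] := expr_small q01 e0; rewrite ltr_pdivlMr // => hN.
have : q ^+ N * c <= q ^+ N * (`|c| + 1).
  rewrite ler_wpM2l ?exprn_ge0 //; first by case/andP: q01.
  by rewrite (le_trans (ler_norm c)) // lerDl.
by have := h N; lra.
Qed.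

Lemma sup_le_nneg (R : realType) (E : set R) (M : R) :
  0 <= M -> (forall x, E x -> x <= M) -> sup E <= M.
Proof.
move=> M0 h; have [[x Ex]|E0] := pselect (E !=set0).
  by apply: ge_sup => //; exists x.
by rewrite (_ : E = set0) ?sup0 //; apply/seteqP; split=> // x Ex; apply: E0; exists x.
Qed.

Lemma linear_comb (R : realType) (U V : lmodType R[i]) (F G : U -> V) c d :
  linear F -> linear G -> linear (fun v => c *: F v - d *: G v).
Proof.
move=> lF lG a x y /=.
by rewrite lF lG scalerBr !scalerDr !scalerA !(mulrC a) opprD addrACA.
Qed.

(** Let X be an operator with 1 + 2 Re X >= 0 and norm at most M, and put
    r = M^2, U = (r - X)/(r + 1).  Then U has norm at most q < 1, so that the
    Neumann series of 1/(1 + X) = (1/(r+1)) * 1/(1 - U) converges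
    geometrically.  The operators P N below are X times its partial sums and
    E N = X U^N are the remainders; all are polynomials in X without constant
    term.  The P N almost are contractions, because X/(1 + X) is one. *)
Section Cayley.
Variables (R : realType) (V : lmodType R[i]) (f : {dot V for @Num.conj R[i]}).
Variables (X : V -> V) (M : R) (E P : nat -> V -> V).
Hypothesis linX : linear X.
Hypothesis M0 : 0 <= M.
Let r := M ^+ 2.
Let rho : R[i] := (r / (r + 1))%:C%C.
Let tau : R[i] := ((r + 1)^-1)%:C%C.
Hypothesis E0 : forall v, E 0 v = X v.
Hypothesis ES : forall N v, E N.+1 v = rho *: E N v - tau *: E N (X v).
Hypothesis P0 : forall v, P 0 v = 0.
Hypothesis PS : forall N v, P N.+1 v = P N v + tau *: E N v.

Definition cayley_rate : R := Num.sqrt (r ^+ 2 + 2 * r) / (r + 1).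

Let r0 : 0 <= r.
Proof. exact: sqr_ge0. Qed.

Let r1 : 0 < r + 1.
Proof. by rewrite ltr_wpDl. Qed.

Lemma cayley_rate_bounds : 0 <= cayley_rate < 1.
Proof.
rewrite divr_ge0 ?sqrtr_ge0 ?(ltW r1) //= ltr_pdivrMr // mul1r.
rewrite -(@ltr_pXn2r _ 2) ?nnegrE ?sqrtr_ge0 ?(ltW r1) // sqr_sqrtr.
  by rewrite sqrrD expr1n mulr1; lra.
by rewrite addr_ge0 ?sqr_ge0 // mulr_ge0.
Qed.

Let rho_tau : rho + tau = 1.
Proof.
rewrite -rmorphD /= -[X in _ + X]mul1r -mulrDl divff //; exact: lt0r_neq0.
Qed.

Lemma cayley_remainder N v : P N (v + X v) = X v - E N v.
Proof.
elim: N => [|N IH]; first by rewrite P0 E0 subrr.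
have linE n : linear (E n).
  elim: n => [|n IHn]; first by move=> a x y; rewrite !E0 linX.
  have lEX : linear (fun v => E n (X v)) by move=> a x y; rewrite linX IHn.
  by move=> a x y; rewrite !ES; exact: (linear_comb rho tau IHn lEX).
rewrite PS IH ES (lin_D (linE N)) scalerDr opprB -addrA; congr (_ + _).
by rewrite -{1}[E N v]scale1r -rho_tau scalerDl opprD addrA subrK addrC.
Qed.

Section Bounds.
Hypothesis normX : forall v, dotnorm f (X v) <= M * dotnorm f v.
Hypothesis ReX : forall v, 0 <= dotnorm f v ^+ 2 + 2 * complex.Re (f (X v) v).

Let U v := rho *: v - tau *: X v.

Let linU : linear U.
Proof. exact: (linear_comb rho tau (fun _ _ _ => erefl) linX). Qed.

Let linUN N : linear (iter N U).
Proof. by elim: N => [|N IH] a x y //=; rewrite IH linU. Qed.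

Let normU v : dotnorm f (U v) <= cayley_rate * dotnorm f v.
Proof.
have -> : U v = tau *: (r%:C%C *: v - X v).
  by rewrite /U scalerBr scalerA -rmorphM /= mulrC.
rewrite dotnormZ /cayley_rate mulrAC mulrC.
have -> : cabs tau = (r + 1)^-1.
  by rewrite /cabs ger0_norm //= ler0c invr_ge0 ltW.
rewrite ler_wpM2r ?invr_ge0 ?(ltW r1) //.
have s0 : 0 <= r ^+ 2 + 2 * r by rewrite addr_ge0 ?sqr_ge0 // mulr_ge0.
rewrite -(@ler_pXn2r _ 2) ?nnegrE ?mulr_ge0 ?sqrtr_ge0 ?dotnorm_ge0 //.
rewrite exprMn (sqr_sqrtr s0) dotnorm_sqrB dotnormZ dotZl ReZ.
rewrite (dotC f v (X v)) cRe_conj.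
rewrite /cabs ger0_norm ?ler0c //= exprMn.
have : r * (2 * complex.Re (f (X v) v)) >= - r * dotnorm f v ^+ 2.
  rewrite mulNr -mulrN ler_wpM2l //; have := ReX v; lra.
have : dotnorm f (X v) ^+ 2 <= r * dotnorm f v ^+ 2.
  rewrite -exprMn ler_pXn2r ?nnegrE ?mulr_ge0 ?dotnorm_ge0 //; exact: normX.
nra.
Qed.

Let normUN N v : dotnorm f (iter N U v) <= cayley_rate ^+ N * dotnorm f v.
Proof.
have /andP[q0 _] := cayley_rate_bounds.
elim: N => [|N IH]; first by rewrite mul1r.
by rewrite exprS -mulrA; apply: le_trans (normU _) _; rewrite ler_wpM2l.
Qed.

Let EE N v : E N v = X (iter N U v).
Proof.
elim: N v => [|N IH] v; first exact: E0.
rewrite ES !IH -!(lin_Z linX) -(lin_B linX) iterSr /U.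
by rewrite (lin_B (linUN N)) !(lin_Z (linUN N)).
Qed.

Lemma cayley_remainder_norm N v :
  dotnorm f (E N v) <= M * cayley_rate ^+ N * dotnorm f v.
Proof.
rewrite EE -mulrA; apply: le_trans (normX _) _.
by rewrite ler_wpM2l ?normUN.
Qed.

(** With G the partial sums of the Neumann series, P N = X G and (1 + X)G =
    1 - U^N; as |Xw| <= |(1 + X)w| for all w, this bounds P N. *)
Lemma cayley_norm N v :
  dotnorm f (P N v) <= (1 + cayley_rate ^+ N) * dotnorm f v.
Proof.
pose G n := \sum_(j < n) tau *: iter j U v.
have PG n : P n v = X (G n).
  elim: n => [|n IH]; first by rewrite P0 /G big_ord0 (lin_0 linX).
  by rewrite PS IH /G big_ord_recr /= (lin_D linX) (lin_Z linX) EE.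
have GU n : G n + X (G n) = v - iter n U v.
  elim: n => [|n IH]; first by rewrite /G big_ord0 (lin_0 linX) subrr addr0.
  rewrite /G big_ord_recr /= -/(G n) (lin_D linX) addrACA IH (lin_Z linX).
  rewrite /U; set y := iter n _ v.
  rewrite opprB -{1}[y]scale1r -rho_tau scalerDl opprD -addrA.
  by congr (_ + _); rewrite addrA subrK addrC.
rewrite PG; apply: (@le_trans _ _ (dotnorm f (G N + X (G N)))).
  rewrite -(@ler_pXn2r _ 2) ?nnegrE ?dotnorm_ge0 // dotnorm_sqrD.
  by have := ReX (G N); rewrite (dotC f (G N) (X (G N))) cRe_conj; lra.
rewrite GU; apply: le_trans (dotnormD _ _ _) _.
by rewrite dotnormN mulrDl mul1r lerD2l normUN.
Qed.

End Bounds.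

End Cayley.

Section MatrixAlgebra.
Variables (R : realType) (K : hilbertType R) (A : set (K -> K)).
Hypothesis hA : is_operator_algebra A.

Definition mx_in n (a : 'M[K -> K]_n) := forall i j, A (a i j).

Definition mx_comp n (a b : 'M[K -> K]_n) : 'M[K -> K]_n :=
  \matrix_(i, j) \sum_l (a i l \o b l j).

Definition mx_comb n (c : R[i]) (a : 'M[K -> K]_n) (d : R[i]) (b : 'M[K -> K]_n) :
  'M[K -> K]_n := \matrix_(i, j) (c *: a i j + d *: b i j).

Lemma mx_in_comp n (a b : 'M[K -> K]_n) : mx_in a -> mx_in b -> mx_in (mx_comp a b).
Proof.
by move=> Aa Ab i j; rewrite mxE; apply: (alg_sum hA) => l _; apply: (algM hA).
Qed.

Lemma mx_in_comb n c (a : 'M[K -> K]_n) d b :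
  mx_in a -> mx_in b -> mx_in (mx_comb c a d b).
Proof. by move=> Aa Ab i j; rewrite mxE; apply: (alg_ZD hA) => //; apply: (algZ hA). Qed.

Variables (H : hilbertType R) (pi : (K -> K) -> (H -> H)).
Hypothesis rpi : is_representation A pi.

Definition amplify n (a : 'M[K -> K]_n) : ('I_n -> H) -> ('I_n -> H) :=
  mxop (map_mx pi a).

Lemma amp_bounded n (a : 'M[K -> K]_n) : mx_in a ->
  forall i j, bounded_ops (map_mx pi a i j).
Proof. by move=> Aa i j; rewrite mxE; apply: (rep_bounded rpi). Qed.

Lemma amp_linear n (a : 'M[K -> K]_n) : mx_in a -> linear (amplify a).
Proof. by move=> /amp_bounded; apply: mxop_linear. Qed.

Lemma amp_norm n (a : 'M[K -> K]_n) v : mx_in a ->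
  tnrm (amplify a v) <= mxopnorm a * tnrm v.
Proof. by move=> Aa; exact: (rep_contractive rpi Aa v). Qed.

Lemma amp_comp n (a b : 'M[K -> K]_n) v : mx_in a -> mx_in b ->
  amplify (mx_comp a b) v = amplify a (amplify b v).
Proof.
move=> Aa Ab; apply: funext => i; rewrite /amplify /mxop.
transitivity (\sum_j \sum_l pi (a i l) (pi (b l j) (v j))).
  apply: eq_bigr => j _; rewrite !mxE (rep_sum hA rpi); last first.
    by move=> l _; apply: (algM hA).
  rewrite fct_sumE; apply: eq_bigr => l _.
  by rewrite (repM rpi).
rewrite exchange_big /=; apply: eq_bigr => l _; rewrite mxE.
rewrite (lin_sum (rep_linear rpi (Aa i l))); apply: eq_bigr => j _.
by rewrite mxE.
Qed.

Lemma amp_comb n c (a : 'M[K -> K]_n) d b v : mx_in a -> mx_in b ->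
  amplify (mx_comb c a d b) v = c *: amplify a v + d *: amplify b v.
Proof.
move=> Aa Ab; apply: funext => i.
change (amplify (mx_comb c a d b) v i = c *: amplify a v i + d *: amplify b v i).
rewrite /amplify /mxop !scaler_sumr -big_split /=; apply: eq_bigr => j _.
rewrite !mxE (rep_ZD rpi) ?(repZ hA rpi) //; exact: (algZ hA).
Qed.

End MatrixAlgebra.

Arguments amplify {R K H} pi {n} a v.

Section CayleyTransfer.
Variables (R : realType) (K : hilbertType R) (A : set (K -> K)).
Hypothesis hA : is_operator_algebra A.
Hypothesis rfd : RFD A.

Lemma rfd_norm_le n (a : 'M[K -> K]_n) (M : R) : mx_in A a -> 0 <= M ->
  (forall (G : hilbertType R) sigma, finite_dim [set: G] ->
     is_representation A sigma ->
     forall v : 'I_n -> G, tnrm (amplify sigma a v) <= M * tnrm v) ->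
  mxopnorm a <= M.
Proof.
move=> Aa M0 h; rewrite (rfd Aa); apply: sup_le_nneg => // _ [G [fG [s rs ->]]].
by apply: mxopnorm_le => // v; apply: h.
Qed.

(** The inequality 1 + 2 Re x >= 0 says that the Cayley transform x/(1 + x) is
    a contraction, and contractivity of elements of M_n(A) passes from the
    finite dimensional representations to all of them.  As A need not have a
    unit, the inequality itself is not one between norms of elements of
    M_n(A). *)
Lemma real_part_transfer n (x : 'M[K -> K]_n) : mx_in A x ->
  (forall (G : hilbertType R) sigma, finite_dim [set: G] ->
     is_representation A sigma ->
     forall v : 'I_n -> G,
       0 <= tnrm v ^+ 2 + 2 * complex.Re (tdot (amplify sigma x v) v)) ->
  forall (H : hilbertType R) pi, is_representation A pi ->
     forall v : 'I_n -> H,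
       0 <= tnrm v ^+ 2 + 2 * complex.Re (tdot (amplify pi x v) v).
Proof.
move=> Ax hx H pi rpi v.
set M := mxopnorm x.
have M0 : 0 <= M by apply: mxopnorm_ge0 => i j; apply: (alg_bounded hA).
pose r := M ^+ 2.
pose rho : R[i] := (r / (r + 1))%:C%C.
pose tau : R[i] := ((r + 1)^-1)%:C%C.
pose E := fix E N := match N with
  | 0%N => x
  | N.+1 => mx_comb rho (E N) (- tau) (mx_comp (E N) x) end.
pose P := fix P N := match N with
  | 0%N => mx_comb 0 x 0 x
  | N.+1 => mx_comb 1 (P N) tau (E N) end.
have AE N : mx_in A (E N).
  by elim: N => //= N IH; apply: mx_in_comb => //; apply: mx_in_comp.
have AP N : mx_in A (P N) by elim: N => [|N IH] /=; apply: mx_in_comb.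
have lin L s (rs : is_representation A s) := @amp_linear _ _ _ L s rs n x Ax.
have ES L s (rs : @is_representation _ _ A L s) N w : amplify s (E N.+1) w =
    rho *: amplify s (E N) w - tau *: amplify s (E N) (amplify s x w).
  have AEx : mx_in A (mx_comp (E N) x) by apply: mx_in_comp.
  by rewrite /= (amp_comb hA rs) // (amp_comp hA rs) // scaleNr.
have P0 L s (rs : @is_representation _ _ A L s) w : amplify s (P 0%N) w = 0.
  by rewrite /= (amp_comb hA rs) // !scale0r addr0.
have PS L s (rs : @is_representation _ _ A L s) N w : amplify s (P N.+1) w =
    amplify s (P N) w + tau *: amplify s (E N) w.
  by rewrite /= (amp_comb hA rs) // scale1r.
set q := cayley_rate M.
have /andP[q0 q1] : 0 <= q < 1 := cayley_rate_bounds M.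
have nE N : mxopnorm (E N) <= M * q ^+ N.
  apply: rfd_norm_le => // [|G s fG rs w]; first by rewrite mulr_ge0 ?exprn_ge0.
  exact: (@cayley_remainder_norm _ _ (@tdot R G n) (amplify s x) M
    (fun N => amplify s (E N)) (lin _ _ rs) M0 (fun=> erefl) (ES _ _ rs)
    (fun u => amp_norm rs u Ax) (hx _ _ fG rs) N w).
have nP N : mxopnorm (P N) <= 1 + q ^+ N.
  apply: rfd_norm_le => // [|G s fG rs w]; first by rewrite addr_ge0 ?exprn_ge0.
  exact: (@cayley_norm _ _ (@tdot R G n) (amplify s x) M
    (fun N => amplify s (E N)) (fun N => amplify s (P N)) (lin _ _ rs) M0
    (fun=> erefl) (ES _ _ rs) (P0 _ _ rs) (PS _ _ rs)
    (fun u => amp_norm rs u Ax) (hx _ _ fG rs) N w).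
set X := amplify pi x.
have : tnrm (X v) <= tnrm (v + X v).
  apply: (le_of_geometric (q := q) (c := tnrm (v + X v) + M * tnrm v)) => [|N].
    by rewrite q0.
  have XE : X v = amplify pi (P N) (v + X v) + amplify pi (E N) v.
    rewrite (@cayley_remainder _ _ X M (fun N => amplify pi (E N))
      (fun N => amplify pi (P N)) (lin _ _ rpi) (fun=> erefl) (ES _ _ rpi)
      (P0 _ _ rpi) (PS _ _ rpi)).
    by rewrite subrK.
  rewrite [leLHS](_ : _ = tnrm (amplify pi (P N) (v + X v) + amplify pi (E N) v)).
    2: by rewrite -XE.
  apply: le_trans (dotnormD _ _ _) _.
  have h1 := le_trans (amp_norm rpi (v + X v) (AP N))
    (ler_wpM2r (dotnorm_ge0 _ _) (nP N)).
  have h2 := le_trans (amp_norm rpi v (AE N))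
    (ler_wpM2r (dotnorm_ge0 _ _) (nE N)).
  apply: le_trans (lerD h1 h2) _; rewrite le_eqVlt; apply/orP; left; apply/eqP.
  by ring.
rewrite -(@ler_pXn2r _ 2) ?nnegrE ?dotnorm_ge0 // dotnorm_sqrD.
by rewrite (dotC (@tdot R H n) v (X v)) cRe_conj; lra.
Qed.

End CayleyTransfer.

(** * Separation from a cone, and positive matrices *)

Section ConeSeparation.
Variables (R : realType) (T : finType) (Cn : set (T -> R)) (p : T -> R).
Hypothesis CnD : forall u w, Cn u -> Cn w -> Cn (fun t => u t + w t).
Hypothesis CnZ : forall (c : R) u, 0 <= c -> Cn u -> Cn (fun t => c * u t).
Hypothesis Cn0 : Cn (fun=> 0).

(** The functional is c - p for an almost closest point c of the cone.  As c
    almost minimises the distance, the inequalities hold up to a multiple eta of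
    the l^1 norm, and eta is so small that the gap at p absorbs a correction of
    size M eta. *)
Lemma cone_almost_separation (delta M : R) :
  0 < delta -> (forall u, Cn u -> delta <= \sum_t (p t - u t) ^+ 2) -> 0 <= M ->
  exists (y : T -> R) (eta : R), [/\ 0 < eta,
    forall u, Cn u -> 0 <= \sum_t y t * u t + eta * \sum_t `|u t| &
    \sum_t y t * p t + eta * M < 0].
Proof.
move=> d0 hd M0; pose N (u : T -> R) := \sum_t u t ^+ 2.
pose D := [set N (fun t => p t - u t) | u in Cn].
have D0 : D (N p).
  by exists (fun=> 0) => //; apply: eq_bigr => t _; rewrite subr0.
have hiD : has_inf D.
  split; first by exists (N p).
  by exists delta => _ [u Cu <-]; apply: hd.
have Dinf u : Cn u -> inf D <= N (fun t => p t - u t).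
  by move=> Cu; apply: inf_lbound; [case: hiD|exists u].
have dD : delta <= inf D.
  by apply: lb_le_inf => [|_ [u Cu <-]]; [exists (N p)|apply: hd].
have DN : inf D <= N p by apply: inf_lbound => //; case: hiD.
pose B := 4 * N p + 2.
have N0 u : 0 <= N u by apply: sumr_ge0 => t _; apply: sqr_ge0.
have B0 : 0 <= B by rewrite addr_ge0 // mulr_ge0.
pose S := 1 + B + 2 * M.
have S0 : 0 < S by rewrite /S; lra.
pose eta := Num.min 1 (delta / S).
have eta0 : 0 < eta by rewrite lt_min ltr01 divr_gt0.
have eta1 : eta <= 1 by rewrite ge_min lexx.
have etaS : eta * S <= delta by rewrite -ler_pdivlMr // ge_min lexx orbT.
have e2 : 0 < eta ^+ 2 by rewrite exprn_gt0.
have [_ [c Cc <-] hc] := inf_adherent e2 hiD.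
pose y t := c t - p t.
have yE : N (fun t => p t - c t) = N y.
  by apply: eq_bigr => t _; rewrite /y -sqrrN opprB.
rewrite yE in hc.
exists y, eta; split=> // [u Cu|].
  set L : R := \sum_t `|u t|; set X := \sum_t y t * u t.
  have L0 : 0 <= L by apply: sumr_ge0.
  have uL t : `|u t| <= L by rewrite /L (bigD1 t) //= lerDl sumr_ge0.
  have NL : N u <= L ^+ 2.
    rewrite expr2 {1}/L mulr_suml; apply: ler_sum => t _.
    by rewrite -real_normK ?num_real // expr2 ler_wpM2l.
  have [Lz|Lnz] := eqVneq L 0.
    rewrite Lz mulr0 addr0 /X big1 // => t _; apply/eqP; rewrite mulf_eq0.
    by apply/orP; right; rewrite -normr_le0 -Lz.
  have Lp : 0 < L by rewrite lt_def Lnz.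
  pose s : R := eta / L; have s0 : 0 < s by rewrite divr_gt0.
  have := Dinf _ (CnD Cc (CnZ (ltW s0) Cu)).
  have -> : N (fun t => p t - (c t + s * u t)) = N y + 2 * s * X + s ^+ 2 * N u.
    rewrite /N /X !mulr_sumr -!big_split /=; apply: eq_bigr => t _.
    by rewrite /y; ring.
  have sL : s * L = eta by rewrite divfK.
  have : s ^+ 2 * N u <= eta ^+ 2.
    rewrite (_ : eta ^+ 2 = s ^+ 2 * L ^+ 2); last by rewrite -exprMn sL.
    by apply: ler_wpM2l => //; apply: sqr_ge0.
  move=> h1 h2; have : 0 <= 2 * s * (X + eta * L).
    have -> : 2 * s * (X + eta * L) = 2 * s * X + 2 * eta * (s * L) by ring.
    rewrite sL; move: hc h1 h2; rewrite !expr2; lra.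
  by rewrite pmulr_rge0 // mulr_gt0.
have h1e : 0 <= 1 - eta by lra.
have := Dinf _ (CnZ h1e Cc); set Y := \sum_t y t * c t.
have -> : N (fun t => p t - (1 - eta) * c t) = N y - 2 * eta * Y + eta ^+ 2 * N c.
  rewrite /N /Y !mulr_sumr -sumrN -!big_split /=; apply: eq_bigr => t _.
  by rewrite /y; ring.
have -> : \sum_t y t * p t = Y - N y.
  rewrite /N /Y -sumrB; apply: eq_bigr => t _.
  by rewrite /y; ring.
have Nc : N c <= B.
  have : N c <= 2 * N p + 2 * N y.
    rewrite /N !mulr_sumr -big_split /=; apply: ler_sum => t _.
    have := sqr_ge0 (c t - 2 * p t); rewrite /y; rewrite -subr_ge0.
    move=> h; rewrite -subr_ge0; apply: le_trans h _.
    by rewrite le_eqVlt; apply/orP; left; apply/eqP; ring.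
  have : eta ^+ 2 <= 1 by rewrite expr_le1 // ltW.
  by rewrite /B; lra.
move=> h; have : 2 * eta * Y <= eta * (eta * (1 + B)).
  have : eta ^+ 2 * N c <= eta ^+ 2 * B by rewrite ler_wpM2l // ltW.
  have -> : eta * (eta * (1 + B)) = eta ^+ 2 + eta ^+ 2 * B by ring.
  lra.
have -> : 2 * eta * Y = eta * (2 * Y) by ring.
rewrite ler_pM2l // => hY.
have : N y >= delta by rewrite -yE; apply: hd.
by move: etaS hY; rewrite /S !mulrDr !mulr1; lra.
Qed.

End ConeSeparation.

Section PositiveMatrix.
Variable R : realType.
Local Notation C := R[i].
Local Open Scope sesquilinear_scope.

(** Spectral theorem: a positive (definite) matrix is of the form S^* S (with
    S invertible). *)
Lemma positive_mx_factor n (D : 'M[C]_n) (c : R) : 0 <= c ->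
  (forall i j, D i j = Num.conj (D j i)) ->
  (forall z : 'I_n -> C, c * \sum_i cabs (z i) ^+ 2 <=
     complex.Re (\sum_i \sum_j Num.conj (z i) * D i j * z j)) ->
  exists S : 'M[C]_n,
    (forall i j, D i j = \sum_k Num.conj (S k i) * S k j) /\
    (0 < c -> S \in unitmx).
Proof.
move=> c0 hD pos.
have hermD : D \is hermsymmx.
  apply/is_hermitianmxP; rewrite expr0 scale1r; apply/matrixP => i j.
  by rewrite !mxE.
have /orthomx_spectralP := hermitian_normalmx hermD.
have /mxOverP spR := hermitian_spectral_diag_real hermD.
set sp := spectral_diag D in spR *; set P := spectralmx D => DE.
have Pu : P \is unitarymx := spectral_unitarymx D.
have PP : P *m P^t* = 1%:M by apply/unitarymxP.
rewrite (invmx_unitary Pu) in DE.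
have spE q : sp 0 q = (P *m D *m P^t*) q q.
  rewrite DE !mulmxA PP mul1mx -mulmxA PP mulmx1 mxE eqxx mulr1n.
  by [].
have spge q : c%:C%C <= sp 0 q.
  have := pos (fun i => Num.conj (P q i)).
  have -> : \sum_i cabs (Num.conj (P q i)) ^+ 2 = 1.
    apply: complexI; rewrite -[RHS](_ : (P *m P^t*) q q = _); last first.
      by rewrite PP mxE eqxx.
    rewrite mxE rmorph_sum /=; apply: eq_bigr => i _.
    by rewrite !mxE -normCK cabsE cabsJ rmorphXn.
  have -> : \sum_i \sum_j
      Num.conj (Num.conj (P q i)) * D i j * Num.conj (P q j) = sp 0 q.
    rewrite spE mxE exchange_big /=; apply: eq_bigr => j _.
    rewrite !mxE mulr_suml; apply: eq_bigr => i _.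
    by rewrite conjCK.
  have := spR 0 q; rewrite mulr1; case: (sp 0 q) => a b.
  by rewrite complex_real => /eqP -> /= h; rewrite lecR.
have sp0 q : 0 <= sp 0 q.
  by apply: le_trans (spge q); rewrite ler0c.
exists (diag_mx (\row_q sqrtC (sp 0 q)) *m P); split=> [i j|cp].
  transitivity ((P^t* *m diag_mx sp *m P) i j); first by rewrite -DE.
  rewrite mxE; apply: eq_bigr => k _.
  have SE l : (diag_mx (\row_q sqrtC (sp 0 q)) *m P) k l = sqrtC (sp 0 k) * P k l.
    rewrite mxE (bigD1 k) //= big1 ?addr0 => [|m mk]; last first.
      by rewrite !mxE eq_sym (negbTE mk) mulr0n mul0r.
    by rewrite !mxE eqxx mulr1n.
  rewrite !SE rmorphM /= mxE (bigD1 k) //= big1 ?addr0 => [|m mk]; last first.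
    by rewrite !mxE (negbTE mk) mulr0n mulr0.
  rewrite !mxE eqxx mulr1n.
  rewrite [Num.conj (sqrtC _)](CrealP _) ?ger0_real ?sqrtC_ge0 //.
  have {1}-> : sp 0 k = sqrtC (sp 0 k) * sqrtC (sp 0 k) by rewrite -expr2 sqrtCK.
  by ring.
rewrite unitmx_mul (unitarymx_unit Pu) andbT unitmxE det_diag unitfE.
apply/prodf_neq0 => q _; rewrite mxE sqrtC_eq0.
apply: lt0r_neq0; apply: lt_le_trans (spge q).
by rewrite ltcR.
Qed.

End PositiveMatrix.

(** * The cone of samples of finite rank representations *)

Lemma ImD (R : realType) (z w : R[i]) :
  complex.Im (z + w) = complex.Im z + complex.Im w.
Proof. by case: z; case: w. Qed.

Lemma ImZ (R : realType) (c : R) (z : R[i]) :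
  complex.Im (c%:C%C * z) = c * complex.Im z.
Proof. by case: z => x y /=; rewrite mul0r addr0. Qed.

(** The real-linear functionals on C are z |-> Re (w z). *)
Lemma real_functional (R : realType) (s t : R) (z : R[i]) :
  s * complex.Re z + t * complex.Im z =
  complex.Re ((s%:C%C - 'i%C * t%:C%C) * z).
Proof. by case: z => x y /=; rewrite !mul0r !mul1r ?oppr0 ?subr0 ?add0r ?addr0; ring. Qed.

Lemma orthogonal_fixed (R : realType) (H : hilbertType R) n m
    (e : 'I_n -> H) (f : 'I_m -> H) x y :
  is_orthonormal (tcat e f) -> transfer e e x = x -> transfer f f y = y ->
  inner H x y = 0.
Proof.
move=> /tcat_orthonormal[_ _ ef] <- <-; rewrite transfer_adj.
by rewrite transfer_orth0 ?dot0r // => i; rewrite transfer_adj transfer_orth0 ?dot0r.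
Qed.

Section ScalarMatrices.
Variables (R : realType) (H : hilbertType R) (k : nat).
Implicit Types (S : 'M[R[i]]_k) (v w : 'I_k -> H).

Definition mx_act S v : 'I_k -> H := fun q => \sum_l S q l *: v l.

Lemma mx_act_comp S T v : mx_act S (mx_act T v) = mx_act (S *m T) v.
Proof.
apply: funext => q; rewrite /mx_act.
transitivity (\sum_l \sum_r (S q l * T l r) *: v r).
  by apply: eq_bigr => l _; rewrite scaler_sumr; apply: eq_bigr => r _; rewrite scalerA.
rewrite exchange_big /=; apply: eq_bigr => r _.
by rewrite mxE scaler_suml.
Qed.

Lemma mx_act1 v : mx_act 1%:M v = v.
Proof.
apply: funext => q; rewrite /mx_act (bigD1 q) //= big1 ?addr0 => [|l lq].
  by rewrite mxE eqxx scale1r.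
by rewrite mxE eq_sym (negbTE lq) scale0r.
Qed.

Lemma tnrm_mx_act S v :
  (tnrm (mx_act S v) ^+ 2)%:C%C =
  \sum_p \sum_l (\sum_q Num.conj (S q p) * S q l) * inner H (v l) (v p).
Proof.
rewrite -dot_sqr /tdot /mx_act.
transitivity (\sum_q \sum_p \sum_l
    Num.conj (S q p) * S q l * inner H (v l) (v p)).
  apply: eq_bigr => q _; rewrite dot_sumr; apply: eq_bigr => p _.
  rewrite dot_suml; apply: eq_bigr => l _.
  by rewrite dotZl dotZr mulrA [S q l * _]mulrC.
rewrite exchange_big /=; apply: eq_bigr => p _.
rewrite exchange_big /=; apply: eq_bigr => l _.
by rewrite mulr_suml.
Qed.

End ScalarMatrices.

Section Approximation.
Variables (R : realType) (K : hilbertType R) (A : set (K -> K)).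
Hypothesis hA : is_operator_algebra A.
Variables (m k : nat) (a : 'I_m -> (K -> K)).
Hypothesis Aa : forall j, A (a j).

Section Data.
Variables (G : hilbertType R) (sigma : (K -> K) -> (G -> G)) (v : 'I_k -> G).

Definition sample (j : 'I_m.+1) : G -> G :=
  if unlift ord0 j is Some i then sigma (a i) else id.

Definition entry (t : 'I_m.+1 * 'I_k * 'I_k) : R[i] :=
  inner G (sample t.1.1 (v t.1.2)) (v t.2).

(** The Gram matrix of v and the matrices of the sigma (a j) on v, as a point
    of a real vector space. *)
Definition coordinates (x : bool * ('I_m.+1 * 'I_k * 'I_k)) : R :=
  if x.1 then complex.Re (entry x.2) else complex.Im (entry x.2).

Lemma sample0 : sample ord0 = id.
Proof. by rewrite /sample unlift_none. Qed.

Lemma sampleS i : sample (lift ord0 i) = sigma (a i).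
Proof. by rewrite /sample liftK. Qed.

Lemma coordinates_le t : is_representation A sigma ->
  `|coordinates t| <= (1 + \sum_j norm1 (a j)) * tnrm v ^+ 2.
Proof.
move=> rs; case: t => b [[j l] p].
have N0 j' : 0 <= norm1 (a j') by apply: norm1_ge0; apply: (alg_bounded hA).
have S0 : 0 <= \sum_j norm1 (a j) by apply: sumr_ge0.
apply: (@le_trans _ _ (cabs (entry (j, l, p)))).
  by case: b; rewrite /coordinates /=; [apply: ler_Re_cabs|apply: ler_Im_cabs].
rewrite /entry /=; apply: le_trans (dot_CS _ _ _) _.
rewrite expr2 mulrA; apply: ler_pM; rewrite ?dotnorm_ge0 ?nrm_le_tnrm //.
apply: (@le_trans _ _ ((1 + \sum_j norm1 (a j)) * nrm (v l))); last first.
  by rewrite ler_wpM2l ?nrm_le_tnrm // addr_ge0.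
case: (unliftP ord0 j) => [i ->|->]; rewrite ?sampleS ?sample0.
  apply: le_trans (rep_norm rs _ (Aa i)) _; rewrite ler_wpM2r ?dotnorm_ge0 //.
  rewrite (bigD1 i) //= addrCA lerDl addr_ge0 // sumr_ge0 //.
by rewrite ler_peMl ?dotnorm_ge0 // lerDl.
Qed.

End Data.

Section Cone.
Variables (H : hilbertType R).
Hypothesis infH : ~ finite_dim [set: H].

Definition finite_rank_rep n (E : 'I_n -> H) (pi : (K -> K) -> (H -> H)) :=
  [/\ is_representation A pi, is_orthonormal E & carried A E pi].

Definition sample_cone : set (bool * ('I_m.+1 * 'I_k * 'I_k) -> R) :=
  [set u | exists n (E : 'I_n -> H) pi (v : 'I_k -> H),
     [/\ finite_rank_rep E pi, (forall l, transfer E E (v l) = v l) &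
         u = coordinates pi v]].

(** Direct sums: the second representation is first moved to a copy of its
    carrier that is orthogonal to the first carrier. *)
Lemma sample_coneD u w : sample_cone u -> sample_cone w ->
  sample_cone (fun t => u t + w t).
Proof.
move=> [n1 [E1 [p1 [v1 [[r1 o1 c1] f1 ->]]]]].
move=> [n2 [E2 [p2 [v2 [[r2 o2 c2] f2 ->]]]]].
have [f of_] := infinite_dim_orthonormal n2 infH o1.
have [_ of' _] := (tcat_orthonormal E1 f).1 of_.
pose q := transfer_rep E2 f p2.
have rq : is_representation A q.
  by apply: transfer_rep_representation => // b x Ab; have [] := c2 b x Ab.
have cq : carried A f q by apply: transfer_rep_carried.
have [rs cs] := sum_representation hA of_ r1 c1 rq cq.
pose w2 l := transfer E2 f (v2 l).
have fw l : transfer f f (w2 l) = w2 l by rewrite /w2 transfer_comp.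
have fw' x : transfer f f x = x -> transfer E1 E1 x = 0.
  move=> <-; apply: transfer_orth0 => i.
  apply: (@eq_trans _ _ (Num.conj 0)); last exact: conjC0.
  by rewrite dotC (orthogonal_fixed of_) ?transfer_at ?transfer_comp.
have fv' x : transfer E1 E1 x = x -> transfer f f x = 0.
  move=> <-; apply: transfer_orth0 => i.
  by rewrite (orthogonal_fixed of_) ?transfer_at ?transfer_comp.
exists (n1 + n2)%N, (tcat E1 f), (fun b => p1 b + q b), (fun l => v1 l + w2 l).
split=> // [l|].
  rewrite transfer_tcat (lin_D (transfer_linear E1 E1)).
  rewrite (lin_D (transfer_linear f f)) f1 fw fw' // fv' //.
  by rewrite addr0 add0r.
suff H1 t : entry (fun b => p1 b + q b) (fun l => v1 l + w2 l) t =
            entry p1 v1 t + entry p2 v2 t.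
  by apply: funext => -[[] t]; rewrite /coordinates /= H1 ?ReD ?ImD.
case: t => [[j l] p]; rewrite /entry /=.
have X x y : transfer E1 E1 x = x -> transfer f f y = y ->
    inner H x y = 0 /\ inner H y x = 0.
  move=> hx hy; have xy := orthogonal_fixed of_ hx hy.
  by split=> //; rewrite dotC xy conjC0.
case: (unliftP ord0 j) => [i ->|->]; rewrite ?sampleS ?sample0; last first.
  rewrite dotDl !dotDr (X _ _ (f1 l) (fw p)).1 (X _ _ (f1 p) (fw l)).2.
  by rewrite addr0 add0r /w2 transfer_isom.
have lp := rep_linear r1 (Aa i); have lq := rep_linear rq (Aa i).
rewrite -[(_ + _) (_ + _)]/(p1 (a i) (v1 l + w2 l) + q (a i) (v1 l + w2 l)).
rewrite (lin_D lp) (lin_D lq).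
have -> : p1 (a i) (w2 l) = 0.
  have [_ <-] := c1 (a i) (w2 l) (Aa i).
  by rewrite (fw' _ (fw l)) (lin_0 lp).
have -> : q (a i) (v1 l) = 0.
  have [_ <-] := cq (a i) (v1 l) (Aa i).
  by rewrite (fv' _ (f1 l)) (lin_0 lq).
have [h1 _] := c1 (a i) (v1 l) (Aa i); have [h2 _] := cq (a i) (w2 l) (Aa i).
rewrite addr0 add0r dotDl !dotDr (X _ _ h1 (fw p)).1 (X _ _ (f1 p) h2).2.
rewrite addr0 add0r /q /transfer_rep /w2 (transfer_comp E2 E2) // f2.
by rewrite transfer_isom //; have [] := c2 (a i) (v2 l) (Aa i).
Qed.

Lemma sample_coneZ (c : R) u : 0 <= c -> sample_cone u ->
  sample_cone (fun t => c * u t).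
Proof.
move=> c0 [n [E [pi [v [[r o ca] f ->]]]]].
pose s : R[i] := (Num.sqrt c)%:C%C.
exists n, E, pi, (fun l => s *: v l); split=> // [l|].
  by rewrite (lin_Z (transfer_linear E E)) f.
suff H1 t : entry pi (fun l => s *: v l) t = c%:C%C * entry pi v t.
  by apply: funext => -[[] t]; rewrite /coordinates /= H1 ?ReZ ?ImZ.
have ss : s * Num.conj s = c%:C%C.
  by rewrite conj_real -rmorphM /= -expr2 sqr_sqrtr.
case: t => [[j l] p]; rewrite /entry /=.
case: (unliftP ord0 j) => [i ->|->]; rewrite ?sampleS ?sample0.
  by rewrite (lin_Z (rep_linear r (Aa i))) dotZl dotZr mulrA ss.
by rewrite dotZl dotZr mulrA ss.
Qed.

Lemma sample_cone0 : sample_cone (fun=> 0).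
Proof.
exists 0%N, (fun=> 0), (fun _ _ => 0), (fun=> 0); split.
- split; [exact: zero_representation|exact: is_orthonormal0|].
  exact: zero_carried.
- by move=> l; apply: transfer_orth0 => -[].
by apply: funext => -[[] t]; rewrite /coordinates /entry /= dot0r.
Qed.

End Cone.

(** A real functional y on the sample points, put into the form v |->
    <Dv, v> + Re <sigma(b)v, v> and then, for D = S^* S, into the form to which
    the transfer principle for real parts applies. *)
Section Functional.
Variables (y : bool * ('I_m.+1 * 'I_k * 'I_k) -> R).

Let Y t : R[i] := (y (true, t))%:C%C - 'i%C * (y (false, t))%:C%C.

(** The hermitian part of the coefficients of y at the Gram matrix, plus c. *)
Definition functional_mx (c : R) : 'M[R[i]]_k := \matrix_(p, l)
  ((Y (ord0, l, p) + Num.conj (Y (ord0, p, l))) / 2 + (c *+ (p == l))%:C%C).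

Let b : 'M[K -> K]_k := \matrix_(p, l) \sum_i Y (lift ord0 i, l, p) *: a i.

(** The element x = (1/2) S^{-*} b S^{-1}, for which b = 2 S^* x S. *)
Definition functional_elt (S : 'M[R[i]]_k) : 'M[K -> K]_k :=
  \matrix_(q, r) \sum_p \sum_l
    (2^-1 * (Num.conj (invmx S p q) * invmx S l r)) *: b p l.

Let Ab : mx_in A b.
Proof. by move=> p l; rewrite mxE; apply: (alg_sum hA) => i _; apply: (algZ hA). Qed.

Lemma functional_elt_in S : mx_in A (functional_elt S).
Proof.
move=> q r; rewrite mxE; apply: (alg_sum hA) => p _; apply: (alg_sum hA) => l _.
by apply: (algZ hA).
Qed.

Lemma functional_mx_herm c p l :
  functional_mx c p l = Num.conj (functional_mx c l p).
Proof.
have c2 : Num.conj (2^-1 : R[i]) = 2^-1 by rewrite fmorphV /= conjC_nat.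
rewrite !mxE [in RHS]eq_sym [RHS]rmorphD /= conj_real; congr (_ + _).
move: (Y (ord0, l, p)) (Y (ord0, p, l)) => z w.
by rewrite [RHS]rmorphM /= c2 (rmorphD Num.conj) /= conjCK addrC.
Qed.

Section Value.
Variables (G : hilbertType R) (sigma : (K -> K) -> (G -> G)) (v : 'I_k -> G).
Hypothesis rs : is_representation A sigma.

Let value_split : \sum_x y x * coordinates sigma v x =
  complex.Re (\sum_l \sum_p Y (ord0, l, p) * inner G (v l) (v p)) +
  complex.Re (tdot (amplify sigma b v) v).
Proof.
transitivity (\sum_c \sum_t y (c, t) * coordinates sigma v (c, t)).
  by rewrite pair_bigA; apply: eq_bigr => -[].
rewrite big_bool -big_split /=.
transitivity (complex.Re (\sum_t Y t * entry sigma v t)).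
  rewrite Re_sum; apply: eq_bigr => t _; exact: real_functional.
rewrite -ReD; congr complex.Re.
transitivity (\sum_j \sum_l \sum_p Y (j, l, p) * entry sigma v (j, l, p)).
  by rewrite pair_bigA pair_bigA; apply: eq_bigr => -[[]].
rewrite big_ord_recl; congr (_ + _).
  apply: eq_bigr => l _; apply: eq_bigr => p _.
  by rewrite /entry sample0.
transitivity (\sum_l \sum_p inner G (sigma (b p l) (v l)) (v p)).
  rewrite exchange_big; apply: eq_bigr => l _ /=.
  rewrite exchange_big; apply: eq_bigr => p _ /=.
  rewrite mxE (rep_sum hA rs); last by move=> i _; apply: (algZ hA).
  rewrite fct_sumE dot_suml; apply: eq_bigr => i _.
  by rewrite /entry /= sampleS (repZ hA rs) // -dotZl.
rewrite exchange_big; apply: eq_bigr => p _ /=.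
rewrite /amplify /mxop dot_suml; apply: eq_bigr => l _.
by rewrite [map_mx _ _ p l]mxE.
Qed.

Let herm_part c :
  complex.Re (\sum_p \sum_l functional_mx c p l * inner G (v l) (v p)) =
  complex.Re (\sum_l \sum_p Y (ord0, l, p) * inner G (v l) (v p)) +
  c * tnrm v ^+ 2.
Proof.
pose Z := \sum_l \sum_p Y (ord0, l, p) * inner G (v l) (v p).
have -> : \sum_p \sum_l functional_mx c p l * inner G (v l) (v p) =
    (Z + Num.conj Z) / 2 + (c * tnrm v ^+ 2)%:C%C.
  have -> : (c * tnrm v ^+ 2)%:C%C =
      \sum_p \sum_l (c *+ (p == l))%:C%C * inner G (v l) (v p).
    rewrite rmorphM /= -dot_sqr /tdot mulr_sumr; apply: eq_bigr => p _.
    rewrite (bigD1 p) //= eqxx mulr1n big1 ?addr0 // => l lp.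
    by rewrite eq_sym (negbTE lp) mulr0n mul0r.
  have -> : (Z + Num.conj Z) / 2 = \sum_p \sum_l
      ((Y (ord0, l, p) + Num.conj (Y (ord0, p, l))) / 2) * inner G (v l) (v p).
    have -> : Num.conj Z =
        \sum_l \sum_p Num.conj (Y (ord0, p, l)) * inner G (v l) (v p).
      rewrite /Z rmorph_sum exchange_big; apply: eq_bigr => l _ /=.
      rewrite rmorph_sum; apply: eq_bigr => p _.
      by rewrite rmorphM /= -dotC.
    rewrite /Z -big_split exchange_big /= mulr_suml; apply: eq_bigr => l _.
    rewrite -big_split /= mulr_suml.
    by apply: eq_bigr => p _; rewrite -mulrDl mulrAC.
  rewrite -big_split; apply: eq_bigr => p _; rewrite -big_split.
  by apply: eq_bigr => l _; rewrite mxE mulrDl.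
have -> : (Z + Num.conj Z) / 2 = (complex.Re Z)%:C%C.
  by rewrite complexRe ReE.
by rewrite -rmorphD.
Qed.

Lemma functional_value (c : R) (S : 'M[R[i]]_k) : S \in unitmx ->
  (forall p l, functional_mx c p l = \sum_q Num.conj (S q p) * S q l) ->
  \sum_x y x * coordinates sigma v x + c * tnrm v ^+ 2 =
  tnrm (mx_act S v) ^+ 2 +
  2 * complex.Re (tdot (amplify sigma (functional_elt S) (mx_act S v)) (mx_act S v)).
Proof.
move=> uS DS; rewrite value_split addrAC -herm_part; congr (_ + _).
  rewrite -[RHS]/(complex.Re (_ %:C%C)) tnrm_mx_act; congr complex.Re.
  by apply: eq_bigr => p _; apply: eq_bigr => l _; rewrite DS.
set w := mx_act S v.
have vE : v = mx_act (invmx S) w by rewrite /w mx_act_comp mulVmx // mx_act1.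
rewrite {1 2}vE -[2]/(2%:R) -[_ * complex.Re _]/(2%:R * _) -ReZ.
congr complex.Re.
rewrite /tdot mulr_sumr.
transitivity (\sum_p \sum_l \sum_q \sum_r
    (Num.conj (invmx S p q) * invmx S l r) * inner G (sigma (b p l) (w r)) (w q)).
  apply: eq_bigr => p _; rewrite /amplify /mxop dot_suml; apply: eq_bigr => l _.
  rewrite mxE /mx_act (lin_sum (rep_linear rs (Ab p l))) dot_sumr.
  apply: eq_bigr => q _; rewrite dot_suml; apply: eq_bigr => r _.
  rewrite (lin_Z (rep_linear rs (Ab p l))) dotZl dotZr mulrA.
  by rewrite [invmx S l r * _]mulrC.
transitivity (\sum_q \sum_r \sum_p \sum_l
    (Num.conj (invmx S p q) * invmx S l r) * inner G (sigma (b p l) (w r)) (w q)).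
  transitivity (\sum_p \sum_q \sum_r \sum_l
    (Num.conj (invmx S p q) * invmx S l r) * inner G (sigma (b p l) (w r)) (w q)).
    apply: eq_bigr => p _; rewrite exchange_big; apply: eq_bigr => q _ /=.
    by rewrite exchange_big.
  rewrite exchange_big; apply: eq_bigr => q _ /=; by rewrite exchange_big.
apply: eq_bigr => q _; rewrite /amplify /mxop dot_suml mulr_sumr.
apply: eq_bigr => r _; rewrite !mxE (rep_sum hA rs); last first.
  by move=> p _; apply: (alg_sum hA) => l _; apply: (algZ hA).
rewrite fct_sumE dot_suml mulr_sumr; apply: eq_bigr => p _.
rewrite (rep_sum hA rs); last by move=> l _; apply: (algZ hA).
rewrite fct_sumE dot_suml mulr_sumr; apply: eq_bigr => l _.
rewrite (repZ hA rs) // dotZl mulrA; congr (_ * _).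
by rewrite [in RHS]mulrA rmorph_nat divff ?mul1r // pnatr_eq0.
Qed.

Lemma functional_value0 (c : R) : (forall z, A z -> sigma z = 0) ->
  \sum_x y x * coordinates sigma v x + c * tnrm v ^+ 2 =
  complex.Re (\sum_p \sum_l functional_mx c p l * inner G (v l) (v p)).
Proof.
move=> s0; rewrite value_split addrAC -herm_part.
have -> : amplify sigma b v = 0.
  apply: funext => i; rewrite /amplify /mxop big1 // => j _.
  by rewrite [map_mx _ _ i j]mxE s0.
by rewrite dot0l addr0.
Qed.

End Value.
End Functional.
End Approximation.

(** * Approximation by finite rank representations *)

Section RfdApproximation.
Variables (R : realType) (K : hilbertType R) (A : set (K -> K)).
Hypothesis hA : is_operator_algebra A.
Hypothesis rfd : RFD A.
Variable (H : hilbertType R).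
Hypothesis infH : ~ finite_dim [set: H].
Variables (pi : (K -> K) -> (H -> H)).
Hypothesis rpi : is_representation A pi.
Variables (m k : nat) (a : 'I_m -> (K -> K)) (e : 'I_k -> H).
Hypothesis Aa : forall j, A (a j).
Hypothesis oe : is_orthonormal e.

(** Otherwise a functional separates the sample of pi on e from the cone of
    samples of finite rank representations.  After adding a small multiple of
    the trace of the Gram matrix it is nonnegative on all finite dimensional
    samples, hence at the sample of pi, where it is negative. *)
Lemma sample_near_cone (delta : R) : 0 < delta ->
  exists2 u, sample_cone A a H u &
    \sum_t (coordinates a pi e t - u t) ^+ 2 < delta.
Proof.
move=> d0; apply: contrapT => no.
have far u : sample_cone A a H u ->
    delta <= \sum_t (coordinates a pi e t - u t) ^+ 2.
  by move=> Cu; rewrite leNgt; apply/negP => lt; apply: no; exists u.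
have N0 j : 0 <= norm1 (a j) by apply: norm1_ge0; apply: (alg_bounded hA).
pose B := 1 + \sum_j norm1 (a j).
have B0 : 0 <= B by rewrite addr_ge0 // sumr_ge0.
pose M0 := #|{: bool * ('I_m.+1 * 'I_k * 'I_k)}|%:R * B + 1.
have M0p : 0 < M0 by rewrite ltr_wpDl // mulr_ge0.
have sumle (G : hilbertType R) sigma (v : 'I_k -> G) : is_representation A sigma ->
    \sum_t `|coordinates a sigma v t| <= M0 * tnrm v ^+ 2.
  move=> rs; apply: (@le_trans _ _
    (\sum_(t : bool * ('I_m.+1 * 'I_k * 'I_k)) B * tnrm v ^+ 2)).
    by apply: ler_sum => t _; apply: (coordinates_le hA Aa).
  rewrite sumr_const -mulr_natl mulrA /M0 mulrDl lerDl mulr_ge0 ?sqr_ge0 //.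
have M1 : 0 <= 2 * M0 * k%:R by rewrite !mulr_ge0 // ltW.
have [y [eta [eta0 ypos yneg]]] := cone_almost_separation
  (sample_coneD hA Aa infH) (sample_coneZ Aa (H := H)) (sample_cone0 hA k a H)
  d0 far M1.
pose c := 2 * eta * M0.
have c0 : 0 < eta * M0 by rewrite mulr_gt0.
have conv n (E : 'I_n -> H) p (v : 'I_k -> H) : finite_rank_rep A E p ->
    (forall l, transfer E E (v l) = v l) ->
    eta * M0 * tnrm v ^+ 2 <=
      \sum_x y x * coordinates a p v x + c * tnrm v ^+ 2.
  move=> Ep Ev.
  have := ypos _ (ex_intro _ n (ex_intro _ E (ex_intro _ p (ex_intro _ v
    (And3 Ep Ev erefl))))).
  have rp : is_representation A p by case: Ep.
  have := ler_wpM2l (ltW eta0) (sumle H p v rp).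
  by rewrite /c !mulrA => h1 h2; lra.
have [f1 of1] := infinite_dim_orthonormal 1 infH (@is_orthonormal0 R H (fun=> 0)).
have {}of1 : is_orthonormal f1 by case/tcat_orthonormal: of1.
have pos (z : 'I_k -> R[i]) : eta * M0 * \sum_i cabs (z i) ^+ 2 <=
    complex.Re (\sum_i \sum_j Num.conj (z i) * functional_mx y c i j * z j).
  pose v l := z l *: f1 ord0.
  have z0 : finite_rank_rep A f1 (fun _ (_ : H) => 0).
    by split=> //; [apply: zero_representation|apply: zero_carried].
  have fv l : transfer f1 f1 (v l) = v l.
    by rewrite /v (lin_Z (transfer_linear f1 f1)) transfer_at.
  have nv : tnrm v ^+ 2 = \sum_i cabs (z i) ^+ 2.
    rewrite tnrm_sqr; apply: eq_bigr => i _; rewrite /v dotnormZ exprMn.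
    by rewrite -[X in _ * X]Re_dot_sqr of1 mulr1.
  have := conv _ _ _ _ z0 fv; rewrite nv => h; apply: le_trans h _.
  rewrite -nv (functional_value0 hA Aa y v (zero_representation hA H)) //.
  rewrite le_eqVlt; apply/orP; left; apply/eqP; congr complex.Re.
  apply: eq_bigr => i _; apply: eq_bigr => j _.
  by rewrite /v dotZl dotZr of1 mulr1; ring.
have [S [SD Su]] := positive_mx_factor (ltW c0) (functional_mx_herm y c) pos.
have {}Su := Su c0.
have Ax := functional_elt_in hA Aa y S.
have hx (G : hilbertType R) sigma : finite_dim [set: G] ->
    is_representation A sigma -> forall w : 'I_k -> G,
    0 <= tnrm w ^+ 2 +
         2 * complex.Re (tdot (amplify sigma (functional_elt a y S) w) w).
  move=> fG rs w; pose v := mx_act (invmx S) w.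
  have -> : w = mx_act S v by rewrite /v mx_act_comp mulmxV // mx_act1.
  rewrite -(functional_value hA Aa v rs Su SD).
  have [n [g [og Pg]]] := finite_dim_orthonormal fG.
  have [f of_] := infinite_dim_orthonormal n infH (@is_orthonormal0 R H (fun=> 0)).
  have {}of_ : is_orthonormal f by case/tcat_orthonormal: of_.
  have gI x : transfer g g x = x by apply: Pg.
  have cE : coordinates a sigma v =
      coordinates a (transfer_rep g f sigma) (fun l => transfer g f (v l)).
    have eE t : entry a sigma v t =
        entry a (transfer_rep g f sigma) (fun l => transfer g f (v l)) t.
      case: t => [[j l] p]; rewrite /entry /=.
      case: (unliftP ord0 j) => [i ->|->]; rewrite ?sampleS ?sample0.
        by rewrite /transfer_rep transfer_comp // gI transfer_isom.
      by rewrite transfer_isom.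
    by apply: funext => -[[] t]; rewrite /coordinates /= eE.
  have tr : is_representation A (transfer_rep g f sigma).
    exact: transfer_rep_representation.
  have := conv n f (transfer_rep g f sigma) (fun l => transfer g f (v l)).
  have nvE : tnrm (fun l => transfer g f (v l)) = tnrm v.
    rewrite /dotnorm; congr (Num.sqrt (complex.Re _)).
    by apply: eq_bigr => i _; rewrite transfer_isom.
  rewrite cE nvE => h; apply: le_trans (h _ _).
  - by rewrite mulr_ge0 ?sqr_ge0 // ltW.
  - by split=> //; apply: transfer_rep_carried.
  - by move=> l; rewrite transfer_comp.
have := real_part_transfer hA rfd Ax hx rpi (mx_act S e).
rewrite -(functional_value hA Aa e rpi Su SD).
have -> : tnrm e ^+ 2 = k%:R.
  rewrite tnrm_sqr (eq_bigr (fun=> 1)) ?sumr_const ?card_ord // => i _.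
  by rewrite -Re_dot_sqr oe eqxx.
by move: yneg; rewrite /c !mulrA [eta * 2]mulrC => h1 h2; lra.
Qed.

End RfdApproximation.

Section AlmostOrthonormal.
Variables (R : realType) (H : hilbertType R) (k : nat) (v : 'I_k -> H) (d : R).
Hypothesis d0 : 0 <= d.
Hypothesis hv : forall l p, cabs (inner H (v l) (v p) - (l == p)%:R) <= d.

(** The Gram matrix differs from the identity by at most d k in operator norm. *)
Lemma almost_orthonormal_sum (z : 'I_k -> R[i]) :
  nrm (\sum_j z j *: v j) ^+ 2 <= (1 + d * k%:R) * \sum_i cabs (z i) ^+ 2.
Proof.
rewrite -Re_dot_sqr dot_sumr Re_sum.
apply: (@le_trans _ _ (\sum_i \sum_j
   ((cabs (z i) ^+ 2) *+ (i == j) + d / 2 * (cabs (z i) ^+ 2 + cabs (z j) ^+ 2)))).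
  apply: ler_sum => i _; rewrite dot_suml Re_sum; apply: ler_sum => j _.
  rewrite dotZl dotZr.
  set g := inner H (v j) (v i).
  have -> : z j * (Num.conj (z i) * g) = (cabs (z i) ^+ 2)%:C%C *+ (i == j) +
      z j * Num.conj (z i) * (g - (j == i)%:R).
    rewrite rmorphXn /= -cabsE normCK [j == i]eq_sym.
    by case: eqVneq => [->|_]; rewrite ?mulr1n ?mulr0n; ring.
  rewrite ReD; apply: lerD; first by case: eqP.
  apply: le_trans (ler_norm _) _; apply: le_trans (ler_Re_cabs _) _.
  rewrite !cabsM cabsJ.
  apply: (@le_trans _ _ (cabs (z j) * cabs (z i) * d)).
    by apply: ler_wpM2l; [rewrite mulr_ge0 ?cabs_ge0|exact: hv].
  have := sqr_ge0 (cabs (z i) - cabs (z j)); have := d0; nra.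
rewrite le_eqVlt; apply/orP; left; apply/eqP.
transitivity (\sum_i ((1 + d / 2 * k%:R) * cabs (z i) ^+ 2 +
    d / 2 * \sum_j cabs (z j) ^+ 2)).
  apply: eq_bigr => i _; rewrite big_split /= (bigD1 i) //= eqxx mulr1n.
  rewrite big1 ?addr0 => [|j ji]; last by rewrite eq_sym (negbTE ji).
  rewrite -mulr_sumr big_split /= sumr_const card_ord -mulr_natl.
  by ring.
rewrite big_split /= -mulr_sumr sumr_const card_ord -mulr_natl.
by field.
Qed.

(** A tuple whose Gram matrix is close to the identity, scaled down to make it
    a contraction, becomes orthonormal after adding a component in a space
    orthogonal to it; that component is the defect operator of the
    contraction. *)
Lemma almost_orthonormal_dilation n (E : 'I_n -> H) :
  ~ finite_dim [set: H] -> is_orthonormal E ->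
  (forall l, transfer E E (v l) = v l) ->
  exists (s : R) (x : 'I_k -> H),
    [/\ 0 <= s ^+ 2 <= 1, 1 - s ^+ 2 <= d * k%:R,
        (forall l, transfer E E (x l) = 0) &
        is_orthonormal (fun l => s%:C%C *: v l + x l)].
Proof.
move=> infH oE Ev; have [f of_] := infinite_dim_orthonormal k infH oE.
have dk : 0 <= d * k%:R by rewrite mulr_ge0.
pose t := (1 + d * k%:R)^-1.
have t1 : 0 < 1 + d * k%:R by rewrite ltr_wpDr.
have t0 : 0 < t by rewrite invr_gt0.
have tE : t * (1 + d * k%:R) = 1 by rewrite mulVf ?lt0r_neq0.
pose D : 'M[R[i]]_k := \matrix_(i, j) ((i == j)%:R - t%:C%C * inner H (v j) (v i)).
have Dh i j : D i j = Num.conj (D j i).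
  rewrite !mxE rmorphB rmorph_nat rmorphM /= conj_real -dotC.
  by rewrite [j == i]eq_sym.
have Dpos (z : 'I_k -> R[i]) : 0 * \sum_i cabs (z i) ^+ 2 <=
    complex.Re (\sum_i \sum_j Num.conj (z i) * D i j * z j).
  rewrite mul0r.
  have -> : \sum_i \sum_j Num.conj (z i) * D i j * z j =
      (\sum_i cabs (z i) ^+ 2 - t * nrm (\sum_j z j *: v j) ^+ 2)%:C%C.
    rewrite rmorphB rmorphM /= -dot_sqr dot_sumr mulr_sumr rmorph_sum /= -sumrB.
    apply: eq_bigr => i _; rewrite dot_suml mulr_sumr.
    have -> : (cabs (z i) ^+ 2)%:C%C =
        \sum_j Num.conj (z i) * (i == j)%:R * z j.
      rewrite (bigD1 i) //= eqxx mulr1 big1 ?addr0 => [|j ji].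
        by rewrite mulrC -normCK cabsE rmorphXn.
      by rewrite eq_sym (negbTE ji) mulr0 mul0r.
    rewrite -sumrB; apply: eq_bigr => j _.
    by rewrite mxE dotZl dotZr; ring.
  rewrite /= subr_ge0.
  have := ler_wpM2l (ltW t0) (almost_orthonormal_sum z).
  by rewrite [leRHS]mulrA tE mul1r.
have tle : t <= 1 by rewrite -tE ler_peMr ?(ltW t0) // lerDl.
have [S [SD _]] := positive_mx_factor (lexx 0) Dh Dpos.
have [_ of' Ef] := (tcat_orthonormal E f).1 of_.
exists (Num.sqrt t), (fun l => \sum_q S q l *: f q).
have st : Num.sqrt t ^+ 2 = t by rewrite sqr_sqrtr // ltW.
have Ex l : transfer E E (\sum_q S q l *: f q) = 0.
  apply: transfer_orth0 => i; rewrite dot_suml big1 // => q _.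
  by rewrite dotZl dotC Ef conjC0 mulr0.
split; rewrite ?st //.
- by rewrite ltW.
- have -> : 1 - t = t * (d * k%:R) by rewrite -[X in X - _]tE; ring.
  by rewrite ler_piMl.
move=> l p.
have X l' p' : inner H (v l') (\sum_q S q p' *: f q) = 0.
  by rewrite -Ev transfer_adj Ex dot0r.
have X' l' p' : inner H (\sum_q S q p' *: f q) (v l') = 0 by rewrite dotC X conjC0.
rewrite dotDl !dotDr !dotZl !dotZr X X' !mulr0 addr0 add0r conj_real.
have -> : inner H (\sum_q S q l *: f q) (\sum_q S q p *: f q) = D p l.
  rewrite SD dot_suml; apply: eq_bigr => q _; rewrite dotZl dot_sumr.
  rewrite (bigD1 q) //= big1 ?addr0 => [|r rq]; last first.
    by rewrite dotZr of' eq_sym (negbTE rq) mulr0.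
  by rewrite dotZr of' eqxx mulr1 mulrC.
rewrite mxE mulrA -rmorphM /= -expr2 st addrC subrK.
by rewrite eq_sym.
Qed.

End AlmostOrthonormal.

(** A point of the cone close to the sample of pi on e comes from a
    representation rho and a tuple v; after v is completed to an orthonormal
    tuple w, a partial isometry moves rho so that w becomes e. *)
Lemma finite_rank_approximation (R : realType) (K : hilbertType R)
    (A : set (K -> K)) (H : hilbertType R) (pi : (K -> K) -> (H -> H)) m k
    (a : 'I_m -> (K -> K)) (e : 'I_k -> H) (eps : R) :
  is_operator_algebra A -> RFD A -> ~ finite_dim [set: H] ->
  is_representation A pi -> (forall j, A (a j)) -> is_orthonormal e -> 0 < eps ->
  exists n (E : 'I_n -> H) rho, finite_rank_rep A E rho /\
    forall j l p, cabs (inner H (rho (a j) (e l)) (e p) -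
                        inner H (pi (a j) (e l)) (e p)) <= eps.
Proof.
move=> hA rfd infH rpi Aa oe eps0.
pose C := \sum_j norm1 (a j).
have N0 j : 0 <= norm1 (a j) by apply: norm1_ge0; apply: (alg_bounded hA).
have C0 : 0 <= C by apply: sumr_ge0.
have B0 : 0 < 1 + k%:R * C by rewrite ltr_wpDr // mulr_ge0.
pose d := eps / (1 + k%:R * C) / 2.
have d0 : 0 < d by rewrite !divr_gt0.
have [u [n [E [rho [v [[rr oE cE] Ev ->]]]]] near] :=
  sample_near_cone hA rfd infH rpi Aa oe (exprn_gt0 2 d0).
have entry_near t : cabs (entry a rho v t - entry a pi e t) <= 2 * d.
  have coord_near b : `|coordinates a rho v (b, t) - coordinates a pi e (b, t)| <= d.
    rewrite distrC -(@ler_pXn2r _ 2) ?nnegrE ?(ltW d0) //.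
    apply: ltW; apply: le_lt_trans near; rewrite real_normK ?num_real //.
    by rewrite (bigD1 (b, t)) //= lerDl; apply: sumr_ge0 => ? _; apply: sqr_ge0.
  apply: le_trans (cabs_le_Re_Im _) _.
  have := coord_near true; have := coord_near false; rewrite /coordinates /=.
  by rewrite -!ReB (_ : complex.Im _ - complex.Im _ = complex.Im
    (entry a rho v t - entry a pi e t)); [lra|case: entry; case: entry].
have gram l p : cabs (inner H (v l) (v p) - (l == p)%:R) <= 2 * d.
  by have := entry_near (ord0, l, p); rewrite /entry !sample0 /= oe.
have d20 : 0 <= 2 * d by rewrite mulr_ge0 // ltW.
have [s [x [/andP[s0 s1] sd Ex ow]]] := almost_orthonormal_dilation d20 gram infH oE Ev.
set w := (fun l => _) in ow.
have [m' [w' [oww fix_ww _]]] := orthonormal_ext [seq E i | i : 'I_n] ow.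
have [e' oee] := infinite_dim_orthonormal m' infH oe.
have Efix y : transfer E E y = y ->
    transfer (tcat w w') (tcat w w') y = y.
  move=> <-; apply: transfer_fixed_by => [|i]; first exact: transfer_linear.
  by apply: fix_ww; rewrite map_f // mem_enum.
exists (k + m')%N, (tcat e e'), (transfer_rep (tcat w w') (tcat e e') rho).
split=> [|j l p].
  split=> //; last exact: transfer_rep_carried.
  apply: transfer_rep_representation => // b y Ab.
  by apply: Efix; have [] := cE b y Ab.
have eE l' : transfer (tcat e e') (tcat w w') (e l') = w l'.
  by rewrite -(tcat_lshift e e') transfer_at // tcat_lshift.
rewrite /transfer_rep eE transfer_adj eE.
have rx l' : rho (a j) (x l') = 0.
  have [_ <-] := cE (a j) (x l') (Aa j).
  by rewrite Ex (lin_0 (rep_linear rr (Aa j))).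
have -> : rho (a j) (w l) = s%:C%C *: rho (a j) (v l).
  rewrite /w (lin_D (rep_linear rr (Aa j))) (lin_Z (rep_linear rr (Aa j))).
  by rewrite rx addr0.
have -> : inner H (s%:C%C *: rho (a j) (v l)) (w p) =
    (s ^+ 2)%:C%C * inner H (rho (a j) (v l)) (v p).
  have [h _] := cE (a j) (v l) (Aa j).
  have -> : inner H (s%:C%C *: rho (a j) (v l)) (w p) =
      s%:C%C * (s%:C%C * inner H (rho (a j) (v l)) (v p)).
    rewrite dotZl /w dotDr dotZr conj_real.
    by rewrite -[X in inner H X (x p)]h transfer_adj Ex dot0r addr0.
  by rewrite mulrA -rmorphM /= -expr2.
have := entry_near (lift ord0 j, l, p); rewrite /entry !sampleS /=.
set z1 := inner H _ _; set z2 := inner H _ _ => hz.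
have hz2 : cabs z2 <= C.
  rewrite /z2; apply: le_trans (dot_CS _ _ _) _.
  have n1 i : nrm (e i) = 1.
    by apply/eqP; rewrite -(@eqrXn2 _ 2) ?dotnorm_ge0 // -Re_dot_sqr oe eqxx expr1n.
  rewrite n1 mulr1; apply: le_trans (rep_norm rpi _ (Aa j)) _.
  by rewrite n1 mulr1 /C (bigD1 j) //= lerDl sumr_ge0.
have -> : (s ^+ 2)%:C%C * z1 - z2 =
    (s ^+ 2)%:C%C * (z1 - z2) + (s ^+ 2 - 1)%:C%C * z2.
  by rewrite rmorphB /= rmorph1; ring.
apply: le_trans (cabsD _ _) _; rewrite !cabsM.
have -> : cabs (s ^+ 2)%:C%C = s ^+ 2 by rewrite /cabs ger0_norm ?ler0c.
have -> : cabs (s ^+ 2 - 1)%:C%C = 1 - s ^+ 2.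
  by rewrite -cabsN -rmorphN /= opprB /cabs ger0_norm ?ler0c ?subr_ge0.
have epsE : eps = 2 * d + 2 * d * k%:R * C.
  by rewrite /d; field; rewrite lt0r_neq0.
rewrite epsE; apply: lerD.
  by apply: le_trans hz; rewrite ler_piMl ?cabs_ge0.
by apply: ler_pM; rewrite ?cabs_ge0 ?subr_ge0.
Qed.

(** * Adjoints, and coordinate spaces as Hilbert spaces *)

Lemma gt0_real_complex (R : realType) (z : R[i]) : 0 < z ->
  exists2 r : R, 0 < r & z = r%:C%C.
Proof.
case: z => x y; rewrite ltcE /= => /andP[/eqP -> x0]; by exists x.
Qed.

Section Tails.
Variables (R : realType) (I : directedType).

#[global] Instance tails_filter : Filter (@tails I).
Proof.
apply: filter_from_filter.
  by case: (directed_inhabited I) => i; exists i.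
move=> i j _ _; have [k [ik jk]] := dle_directed i j; exists k => // l kl.
by split; [exact: dle_trans ik kl|exact: dle_trans jk kl].
Qed.

Variable V : pseudoMetricNormedZmodType R[i].

Lemma tails_cvg (u : I -> V) (l : V) :
  (forall eps : R, 0 < eps -> exists i, forall j, dle i j ->
     `|l - u j| <= eps%:C%C) -> u @ @tails I --> l.
Proof.
move=> h; apply/cvgrPdist_le => z /gt0_real_complex[eps eps0 ->].
by have [i hi] := h eps eps0; exists i.
Qed.

Lemma cvg_tails (u : I -> V) (l : V) (eps : R) : u @ @tails I --> l -> 0 < eps ->
  (@tails I) [set i | `|l - u i| <= eps%:C%C].
Proof.
by move=> /cvgrPdist_le h e0; apply: h; rewrite -(rmorph0 (real_complex R)) ltcR.
Qed.

Lemma tails_ex (E : set I) : (@tails I) E -> exists i, E i.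
Proof. by move=> [i _ h]; exists i; apply: h; apply: dle_refl. Qed.

End Tails.

Section Riesz.
Variables (R : realType) (H : hilbertType R).

Lemma hilbert_cauchy (u : nat -> H) (r : nat -> R) :
  (forall eps : R, 0 < eps -> exists N, forall n, (N <= n)%N -> r n < eps) ->
  (forall n p, nrm (u n - u p) <= r n + r p) ->
  exists l, forall eps : R, 0 < eps -> exists N, forall n, (N <= n)%N ->
    nrm (l - u n) <= eps.
Proof.
move=> r0 hu.
have /cauchy_cvgP : cauchy (u @ \oo).
  apply: cauchy_exP => z /gt0_real_complex[eps eps0 ->].
  have [N hN] := r0 (eps / 2) (divr_gt0 eps0 (ltr0n _ 2)).
  exists (u N); exists N => // n /= Nn.
  rewrite -ball_normE /= normr_hnorm ltcR hnormE.
  apply: le_lt_trans (hu N n) _.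
  by have := hN N (leqnn N); have := hN n Nn; lra.
move=> /cvg_ex[l /= hl]; exists l => eps eps0.
have e0 : 0 < eps%:C%C :> R[i] by rewrite -(rmorph0 (real_complex R)) ltcR.
have /cvgrPdist_le/(_ _ e0)[N _ hN] := hl.
exists N => n Nn; have := hN n Nn.
by rewrite /= normr_hnorm lecR hnormE.
Qed.

(** Riesz: the representing vector is the minimiser of |x|^2 - 2 Re phi x; by
    the parallelogram law, minimising sequences are Cauchy. *)
Lemma riesz (phi : H -> R[i]) (L : R) :
  (forall c x y, phi (c *: x + y) = c * phi x + phi y) ->
  (forall x, cabs (phi x) <= L * nrm x) ->
  exists s, forall x, phi x = inner H x s.
Proof.
move=> phiL phiB.
have phi0 : phi 0 = 0.
  by have := phiL (-1) 0 0; rewrite scaler0 addr0 mulN1r addNr.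
have phiD x y : phi (x + y) = phi x + phi y.
  by have := phiL 1 x y; rewrite scale1r mul1r.
have phiZ c x : phi (c *: x) = c * phi x.
  by have := phiL c x 0; rewrite !addr0 phi0 addr0.
pose J x := nrm x ^+ 2 - 2 * complex.Re (phi x).
have Jlow x : - L ^+ 2 <= J x.
  have h1 : complex.Re (phi x) <= L * nrm x.
    by apply: le_trans (phiB x); apply: le_trans (ler_Re_cabs _); apply: ler_norm.
  by have := sqr_ge0 (nrm x - L); rewrite /J; nra.
pose D := [set J x | x in [set: H]].
have hD : has_inf D.
  by split; [exists (J 0), 0|exists (- L ^+ 2) => _ [x _ <-]].
have infJ x : inf D <= J x by apply: inf_lbound; [case: hD|exists x].
pose r n : R := 2^-1 ^+ n.
have rp n : 0 < r n by rewrite exprn_gt0.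
have r0 (eps : R) : 0 < eps -> exists N, forall n, (N <= n)%N -> r n < eps.
  move=> e0; have q1 : 0 <= (2^-1 : R) < 1 by rewrite invr_ge0 ler0n /= invf_lt1 // ltr1n.
  have [N hN] := expr_small q1 e0; exists N => n Nn.
  apply: le_lt_trans hN; rewrite /r ler_wiXn2l // ?invr_ge0 //.
  by case/andP: q1 => _ /ltW.
have /choice[u hu] n : exists x, J x < inf D + r n ^+ 2.
  by have [_ [x _ <-] hx] := inf_adherent (exprn_gt0 2 (rp n)) hD; exists x.
have cauchy_u n p : nrm (u n - u p) <= 2 * r n + 2 * r p.
  have mid : nrm (u n - u p) ^+ 2 = 2 * J (u n) + 2 * J (u p) -
      4 * J (2^-1%:C%C *: (u n + u p)).
    rewrite /J dotnormZ phiZ ReZ phiD ReD dotnorm_sqrB exprMn dotnorm_sqrD.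
    rewrite (_ : cabs 2^-1%:C%C = 2^-1); last first.
      by rewrite /cabs ger0_norm ?ler0c ?invr_ge0.
    by field.
  rewrite -(@ler_pXn2r _ 2) ?nnegrE ?dotnorm_ge0 ?addr_ge0 ?mulr_ge0 ?(ltW (rp _)) //.
  rewrite mid; have := infJ (2^-1%:C%C *: (u n + u p)).
  have := hu n; have := hu p; have := rp n; have := rp p; nra.
have r0' (eps : R) : 0 < eps -> exists N, forall n, (N <= n)%N -> 2 * r n < eps.
  move=> e0; have [N hN] := r0 (eps / 2) (divr_gt0 e0 (ltr0n _ 2)).
  by exists N => n /hN; lra.
have [s hs] := hilbert_cauchy r0' cauchy_u.
have Re_ge h : 0 <= complex.Re (inner H h s - phi h).
  rewrite leNgt; apply/negP => neg; set q := complex.Re _ in neg.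
  pose B := 1 + nrm h + nrm h ^+ 2.
  have h0 : 0 <= nrm h := dotnorm_ge0 _ _.
  have B0 : 0 < B by rewrite /B; nra.
  have e0 : 0 < - q / (2 * B) by rewrite divr_gt0 ?oppr_gt0 // mulr_gt0.
  have [N1 hN1] := r0 _ e0; have [N2 hN2] := hs _ e0.
  pose n := maxn N1 N2.
  have := hN1 n (leq_maxl _ _); have := hN2 n (leq_maxr _ _).
  rewrite ltr_pdivlMr ?mulr_gt0 // ler_pdivlMr ?mulr_gt0 // => hs' hr'.
  have := infJ (u n + (r n)%:C%C *: h).
  rewrite /J dotnorm_sqrD dotnormZ dotZr conj_real phiD phiZ !ReD !ReZ.
  rewrite (_ : cabs (r n)%:C%C = r n); last first.
    by rewrite /cabs ger0_norm ?ler0c ?(ltW (rp n)).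
  rewrite exprMn => hJ.
  have var : - r n * (1 + nrm h ^+ 2) <=
      2 * (complex.Re (inner H (u n) h) - complex.Re (phi h)).
    have := hu n; rewrite /J => hJ'.
    rewrite -(ler_pM2l (rp n)); move: hJ hJ' (rp n); rewrite !expr2; nra.
  have lim : complex.Re (inner H (u n) h) <=
      complex.Re (inner H h s) + nrm (s - u n) * nrm h.
    have -> : inner H (u n) h = inner H s h - inner H (s - u n) h.
      by rewrite dotBl opprB addrC subrK.
    rewrite ReB (dotC _ h s) cRe_conj lerD2l.
    apply: le_trans (ler_norm _) _; rewrite normrN.
    exact: le_trans (ler_Re_cabs _) (dot_CS _ _ _).
  move: neg; rewrite -/q; have qE : q = complex.Re (inner H h s) - complex.Re (phi h).
    by rewrite /q ReB.
  move=> neg.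
  have hsn : nrm (s - u n) * nrm h <= nrm (s - u n) * B.
    by rewrite ler_wpM2l ?dotnorm_ge0 // /B; nra.
  have hrn : r n * (1 + nrm h ^+ 2) <= r n * B.
    by rewrite ler_wpM2l ?(ltW (rp n)) // /B; nra.
  suff : q < q by rewrite ltxx.
  lra.
have Re_eq h : complex.Re (inner H h s - phi h) = 0.
  apply/eqP; rewrite eq_le Re_ge andbT.
  have := Re_ge (- h); rewrite dotNl -scaleN1r phiZ mulN1r opprK ReD.
  by rewrite ReB; case: (inner H h s) => ? ? /=; lra.
exists s => h; apply/esym/subr0_eq.
have h1 := Re_eq h; have := Re_eq ('i%C *: h); rewrite dotZl phiZ -mulrBr.
move: h1; case: (inner H h s - phi h) => x y /= ->.
rewrite mul0r mul1r sub0r => /eqP; rewrite oppr_eq0 => /eqP ->.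
by [].
Qed.

Lemma adjointP (T : H -> H) : bounded_ops T -> is_adjoint T (adjoint T).
Proof.
move=> bT; have lT : linear T by case: bT.
have /choice[S hS] y : exists s, forall x, inner H (T x) y = inner H x s.
  apply: (@riesz _ (opnorm T * nrm y)) => [c u v|u].
    by rewrite lT dotDl dotZl.
  apply: le_trans (dot_CS _ _ _) _; rewrite mulrAC.
  by rewrite ler_wpM2r ?dotnorm_ge0 ?le_opnorm.
have TS : is_adjoint T S by move=> x y; rewrite hS.
by rewrite (adjoint_uniq TS).
Qed.

End Riesz.

(** The coordinate space of an orthonormal tuple e, with the norm and the inner
    product that make the coordinate map isometric. *)
Section CoordinateSpace.
Variables (R : realType) (K : hilbertType R) (n : nat) (e : 'I_n -> K).

Definition coordinate_space (oe : is_orthonormal e) : Type := 'rV[R[i]]_n.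

Variable oe : is_orthonormal e.
Let V := coordinate_space oe.

HB.instance Definition _ := GRing.Lmodule.copy V 'rV[R[i]]_n.

Definition embed (x : V) : K := \sum_i (x : 'rV[R[i]]_n) ord0 i *: e i.

Lemma embed_linear : linear embed.
Proof.
move=> c x y; rewrite /embed scaler_sumr -big_split /=.
by apply: eq_bigr => i _; rewrite !mxE scalerDl scalerA.
Qed.

Lemma inner_embed x i : inner K (embed x) (e i) = (x : 'rV[R[i]]_n) ord0 i.
Proof.
rewrite /embed dot_suml (bigD1 i) //= dotZl oe eqxx mulr1 big1 ?addr0 // => j ji.
by rewrite dotZl oe (negbTE ji) mulr0.
Qed.

Lemma embed_inj x : embed x = 0 -> x = 0.
Proof.
move=> x0; apply/rowP => i; rewrite mxE.
by have := inner_embed x i; rewrite x0 dot0l => /esym.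
Qed.

Definition coordinates_of (z : K) : V := \row_i inner K z (e i).

Lemma embed_coordinates z : embed (coordinates_of z) = transfer e e z.
Proof. by apply: eq_bigr => i _; rewrite mxE. Qed.

Definition coordinate_norm (x : V) : R[i] := `|embed x|.

Lemma coordinate_normD x y :
  coordinate_norm (x + y) <= coordinate_norm x + coordinate_norm y.
Proof. by rewrite /coordinate_norm (lin_D embed_linear) ler_normD. Qed.

Lemma coordinate_normZ (c : R[i]) x :
  coordinate_norm (c *: x) = `|c| * coordinate_norm x.
Proof. by rewrite /coordinate_norm (lin_Z embed_linear) normrZ. Qed.

Lemma coordinate_norm_eq0 x : coordinate_norm x = 0 -> x = 0.
Proof. by move/normr0_eq0/embed_inj. Qed.

HB.instance Definition _ := Lmodule_isNormed.Build R[i] V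
  coordinate_normD coordinate_normZ coordinate_norm_eq0.

Lemma coordinate_normE (x : V) : `|x| = `|embed x|.
Proof. by []. Qed.

(** A Cauchy filter converges in K after embedding, and the projection onto the
    span of e, being contractive, brings the limit back. *)
Lemma coordinate_complete (F : set_system V) :
  ProperFilter F -> cauchy F -> cvg F.
Proof.
move=> PF /cauchyP cF.
have /cauchy_cvgP/cvg_ex[z hz] : cauchy (embed @ F).
  apply: cauchy_exP => eps /cF[x Fx]; exists (embed x).
  suff : F (embed @^-1` ball (embed x) eps) by [].
  apply: filterS Fx => y; rewrite -!ball_normE /=.
  by rewrite coordinate_normE (lin_B embed_linear).
apply/cvg_ex; exists (coordinates_of z).
apply/fcvgrPdist_lt => eps eps0.
have /cvgrPdist_lt/(_ _ eps0) := hz; apply: filterS => x /=.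
apply: le_lt_trans; rewrite coordinate_normE (lin_B embed_linear).
rewrite embed_coordinates.
have xe : transfer e e (embed x) = embed x.
  by apply: eq_bigr => i _; rewrite inner_embed.
rewrite -{1}xe -(lin_B (transfer_linear e e)) !normr_hnorm lecR !hnormE.
exact: transfer_norm.
Qed.

HB.instance Definition _ := Uniform_isComplete.Build V coordinate_complete.

Definition coordinate_inner (x y : V) : R[i] := inner K (embed x) (embed y).

Lemma coordinate_inner_bilinear :
  bilinear_for (GRing.Scale.Law.clone _ _ *%R _)
    (GRing.Scale.Law.clone _ _ (@Num.conj R[i] \; *%R) _) coordinate_inner.
Proof.
split=> [u c x y|u c x y]; rewrite /coordinate_inner embed_linear.
  by rewrite dotDl dotZl.
by rewrite dotDr dotZr.
Qed.

HB.instance Definition _ := bilinear_isBilinear.Build _ _ _ _ _ _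
  coordinate_inner coordinate_inner_bilinear.

Lemma coordinate_inner_hermitian x y :
  coordinate_inner x y = (-1) ^+ false * Num.conj (coordinate_inner y x).
Proof. by rewrite expr0 mul1r; exact: dotC. Qed.

HB.instance Definition _ := isHermitianSesquilinear.Build _ _ _ _
  coordinate_inner coordinate_inner_hermitian.

Lemma coordinate_inner_posdef x : x != 0 -> 0 < coordinate_inner x x.
Proof.
move=> x0; rewrite /coordinate_inner dnorm_gt0; apply: contra x0 => /eqP/embed_inj.
by move=> ->.
Qed.

HB.instance Definition _ := isDotProduct.Build _ _
  coordinate_inner coordinate_inner_posdef.

Lemma coordinate_inner_norm x : `|x| ^+ 2 = coordinate_inner x x.
Proof. by rewrite coordinate_normE inner_norm. Qed.

Definition coordinate_hilbert : hilbertType R :=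
  Hilbert coordinate_inner_norm.

End CoordinateSpace.

Lemma finite_dim_model (R : realType) (K : hilbertType R) n (e : 'I_n -> K) :
  is_orthonormal e ->
  exists (G : hilbertType R) (f : 'I_n -> G),
    is_orthonormal f /\ forall x, transfer f f x = x.
Proof.
move=> oe; pose f i : coordinate_hilbert oe := coordinates_of oe (e i).
have fe i : embed (f i) = e i by rewrite embed_coordinates transfer_at.
exists (coordinate_hilbert oe), f; split=> [i j|x].
  by rewrite -[LHS]/(inner K (embed (f i)) (embed (f j))) !fe oe.
apply/subr0_eq/(embed_inj (oe := oe)); rewrite (lin_B (@embed_linear _ _ _ _ oe)).
rewrite {1}/transfer (lin_sum (@embed_linear _ _ _ _ oe)).
apply/eqP; rewrite subr_eq0; apply/eqP; rewrite [RHS]/embed.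
apply: eq_bigr => i _; rewrite (lin_Z (@embed_linear _ _ _ _ oe)) fe.
by rewrite -[inner _ x (f i)]/(inner K (embed x) (embed (f i))) fe inner_embed.
Qed.

(** * Nets of representations *)

Lemma transfer_projection (R : realType) (H : hilbertType R) n (e : 'I_n -> H) : is_orthonormal e ->
  is_projection (transfer e e) /\ finite_rank (transfer e e).
Proof.
move=> oe; split.
  split.
  - apply/bounded_opsE; split; first exact: transfer_linear.
    by exists 1 => x; rewrite mul1r transfer_norm.
  - by apply: funext => x /=; rewrite transfer_comp.
  - by apply: adjoint_uniq => x y; rewrite transfer_adj.
apply: (orthonormal_finite_dim (e := e)) => _ [x _ <-].
by rewrite transfer_comp.
Qed.

Lemma transfer_op_le (R : realType) (H : hilbertType R) n m (e : 'I_n -> H) (f : 'I_m -> H) :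
  is_orthonormal e -> is_orthonormal f ->
  (forall i, transfer f f (e i) = e i) ->
  op_le (transfer e e) (transfer f f).
Proof.
move=> oe of_ fe x.
have FE y : transfer f f (transfer e e y) = transfer e e y.
  by apply: transfer_fixed_by fe; apply: transfer_linear.
have EF y : transfer e e (transfer f f y) = transfer e e y.
  apply: (@dot_ext _ _ (inner H)) => z.
  by rewrite transfer_adj transfer_adj FE -transfer_adj.
have sq k (g : 'I_k -> H) : is_orthonormal g ->
    inner H (transfer g g x) x = (nrm (transfer g g x) ^+ 2)%:C%C.
  by move=> og; rewrite -dot_sqr [RHS]transfer_adj transfer_comp // -transfer_adj.
rewrite dotBl !sq // subr_ge0 lecR ler_pXn2r ?nnegrE ?dotnorm_ge0 //.
by rewrite -EF transfer_norm.
Qed.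

Lemma sum2_const (R : realType) n (z : R) :
  \sum_(l < n) \sum_(p < n) z = n%:R ^+ 2 * z.
Proof. by rewrite !sumr_const !card_ord -mulrnA -[LHS]mulr_natl natrM expr2. Qed.

Lemma id_projection (R : realType) (H : hilbertType R) : is_projection (@id H).
Proof.
split=> //; last exact: adjoint_uniq.
by apply/bounded_opsE; split=> //; exists 1 => x; rewrite mul1r.
Qed.

Section Nets.
Variables (R : realType) (K : hilbertType R) (A : set (K -> K)).
Hypothesis hA : is_operator_algebra A.

Section TransferNet.
Variables (H : hilbertType R) (pi : (K -> K) -> (H -> H)).
Hypothesis rpi : is_representation A pi.

(** The n^2 matrix coefficients at the tuple control the compression to its
    span in operator norm. *)
Lemma compression_approximation n (e : 'I_n -> H) (t : seq (K -> K)) (eps : R) :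
  RFD A -> ~ finite_dim [set: H] -> is_orthonormal e -> 0 < eps ->
  exists rho, finite_dim_representation A rho /\
    forall a, a \in t -> A a -> forall x y,
      transfer e e x = x -> transfer e e y = y ->
      cabs (inner H (rho a x) y - inner H (pi a x) y) <= eps * nrm x * nrm y.
Proof.
move=> rfd infH oe eps0.
pose t' := [seq a <- t | `[< A a >]].
pose a_ (j : 'I_(size t')) := nth 0 t' j.
have Aa j : A (a_ j).
  have : a_ j \in t' by apply: mem_nth.
  by rewrite mem_filter => /andP[/asboolP].
pose d := eps / (n%:R ^+ 2 + 1).
have n0 : 0 < n%:R ^+ 2 + 1 :> R by rewrite ltr_wpDl ?sqr_ge0.
have d0 : 0 < d by rewrite divr_gt0.
have [m [E [rho [[rr oE cE] near]]]] :=
  finite_rank_approximation hA rfd infH rpi Aa oe d0.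
exists rho; split; first exact: (carried_finite_dim oE).
move=> a at_ Aa' x y ex ey.
have at' : a \in t' by rewrite mem_filter at_ andbT; apply/asboolP.
have {}near l p : cabs (inner H (rho a (e l)) (e p) -
                             inner H (pi a (e l)) (e p)) <= d.
  have lt : (index a t' < size t')%N by rewrite index_mem.
  have := near (Ordinal lt) l p.
  by rewrite /a_ /= nth_index.
have xl (z : H) l : cabs (inner H z (e l)) <= nrm z.
  apply: le_trans (dot_CS _ _ _) _.
  rewrite (_ : nrm (e l) = 1) ?mulr1 //.
  by apply/eqP; rewrite -(@eqrXn2 _ 2) ?dotnorm_ge0 // -Re_dot_sqr oe eqxx expr1n.
have expand (s : H -> H) : linear s -> inner H (s x) y =
    \sum_l \sum_p inner H x (e l) * Num.conj (inner H y (e p)) *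
      inner H (s (e l)) (e p).
  move=> ls; rewrite -{1}ex -{1}ey {1 2}/transfer (lin_sum ls) dot_suml.
  apply: eq_bigr => l _; rewrite dot_sumr; apply: eq_bigr => p _.
  by rewrite (lin_Z ls) dotZl dotZr mulrA.
rewrite (expand _ (rep_linear rr Aa')) (expand _ (rep_linear rpi Aa')).
rewrite -sumrB; apply: le_trans (cabs_sum _ _ _) _.
apply: (@le_trans _ _ (\sum_(l < n) \sum_(p < n) nrm x * nrm y * d)).
  apply: ler_sum => l _; rewrite -sumrB.
  apply: le_trans (cabs_sum _ _ _) _; apply: ler_sum => p _.
  rewrite -mulrBr !cabsM cabsJ.
  by do 2 ?[apply: ler_pM => //; rewrite ?mulr_ge0 ?cabs_ge0].
rewrite sum2_const.
rewrite (_ : _ * _ = (n%:R ^+ 2 * d) * (nrm x * nrm y)); last by ring.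
rewrite -[leRHS]mulrA ler_wpM2r ?mulr_ge0 ?dotnorm_ge0 //.
rewrite /d mulrCA ler_piMr ?(ltW eps0) // ler_pdivrMr // mul1r.
by rewrite lerDl.
Qed.

End TransferNet.

Lemma unit_dle_directed (i j : unit) : exists k : unit, True /\ True.
Proof. by exists tt. Qed.

Definition unit_directed : directedType :=
  @Directed unit (fun _ _ => True) (fun=> I) (fun _ _ _ _ _ => I)
    unit_dle_directed (inhabits tt).

(** Indices of the approximating net: vectors that the projection must fix,
    elements of A on which the representation must be close to pi, and the
    number of binary digits of the precision. *)
Section Index.
Variable H : hilbertType R.
Let T := (seq H * seq (K -> K) * nat)%type.

Definition index_le (i j : T) : Prop :=
  [/\ {subset i.1.1 <= j.1.1}, {subset i.1.2 <= j.1.2} & (i.2 <= j.2)%N].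

Lemma index_le_refl i : index_le i i.
Proof. by split. Qed.

Lemma index_le_trans i j k : index_le i j -> index_le j k -> index_le i k.
Proof.
move=> [a1 a2 a3] [b1 b2 b3]; split; last exact: leq_trans a3 b3.
  by move=> x /a1/b1.
by move=> x /a2/b2.
Qed.

Lemma index_le_directed i j : exists k, index_le i k /\ index_le j k.
Proof.
exists (i.1.1 ++ j.1.1, i.1.2 ++ j.1.2, maxn i.2 j.2).
by split; split=> /= [x|x|]; rewrite ?mem_cat ?leq_maxl ?leq_maxr // => ->;
  rewrite ?orbT.
Qed.

Definition index_directed : directedType :=
  Directed index_le_refl index_le_trans index_le_directed
    (inhabits ([::], [::], 0%N)).

End Index.

Lemma nrm_le_sqr (H : hilbertType R) (d : H) (c : R) :
  0 <= c -> nrm d ^+ 2 <= c * nrm d -> nrm d <= c.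
Proof.
move=> c0 h; have [->//|nz] := eqVneq (nrm d) 0.
by rewrite -(@ler_pM2r _ (nrm d)) -?expr2 // lt_def nz dotnorm_ge0.
Qed.

(** On the span of the vectors of an index i, the compressions of pi_ i and pi
    differ in norm by at most prec i.  So x, pi(a)x, pi(a)^*x (or x and y) only
    have to be among the vectors of the index: the differences d below then lie
    in the span, and |d|^2 is bounded by prec i |x||d|. *)
Theorem rfd_approximating_net (H : hilbertType R) (pi : (K -> K) -> (H -> H)) :
  RFD A -> is_representation A pi ->
  exists (I : directedType) (pi_ : I -> (K -> K) -> (H -> H)) (P_ : I -> H -> H),
    [/\ forall i, finite_dim_representation A (pi_ i),
        forall i, is_projection (P_ i) /\ finite_rank (P_ i),
        increasing_net P_,
        forall a, A a -> SOTstar_cvg (fun i => P_ i \o pi_ i a \o P_ i) (pi a) &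
        forall a, A a -> WOT_cvg (fun i => pi_ i a) (pi a)].
Proof.
move=> rfd rpi; have [finH|infH] := pselect (finite_dim [set: H]).
  have fin E : @finite_dim R H E.
    by have [n [v hv]] := finH; exists n, v => x _; apply: hv.
  exists unit_directed, (fun=> pi), (fun=> id); split.
  - by move=> _; split.
  - by move=> _; split; [exact: id_projection|exact: fin].
  - by move=> _ _ _ x; rewrite subrr dot0l.
  - by move=> a Aa; split=> x; apply: tails_cvg => eps eps0; exists tt => j _;
      rewrite subrr normr0 ler0c ltW.
  - move=> a Aa x y; apply: tails_cvg => eps eps0; exists tt => j _.
    by rewrite subrr normr0 ler0c ltW.
pose I := index_directed H.
pose prec (i : I) : R := 2^-1 ^+ i.2.
have prec0 i : 0 < prec i by rewrite exprn_gt0 // invr_gt0.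
have /choice[Q hQ] (i : I) : exists Q : (H -> H) * ((K -> K) -> (H -> H)),
    finite_dim_representation A Q.2 /\
    (exists n (e : 'I_n -> H), [/\ Q.1 = transfer e e, is_orthonormal e,
      (forall x, x \in i.1.1 -> transfer e e x = x),
      (forall T : H -> H, linear T -> (forall x, x \in i.1.1 -> T x = x) ->
         forall j, T (e j) = e j) &
      (forall a, a \in i.1.2 -> A a -> forall x y,
        transfer e e x = x -> transfer e e y = y ->
        cabs (inner H (Q.2 a x) y - inner H (pi a x) y) <=
          prec i * nrm x * nrm y)]).
  have [n [e [oe es eT]]] := orthonormal_span i.1.1.
  have [rho [frho rhoE]] := compression_approximation rpi i.1.2 rfd infH oe (prec0 i).
  by exists (transfer e e, rho); split=> //; exists n, e.
have small (c eps : R) : 0 <= c -> 0 < eps ->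
    exists N, forall n, (N <= n)%N -> 2^-1 ^+ n * c <= eps.
  move=> c0 eps0; have c1 : 0 < c + 1 by rewrite ltr_wpDl.
  have q1 : 0 <= (2^-1 : R) < 1 by rewrite invr_ge0 ler0n /= invf_lt1 // ltr1n.
  have [N hN] := expr_small q1 (divr_gt0 eps0 c1).
  exists N => n Nn; apply: (@le_trans _ _ (2^-1 ^+ N * (c + 1))).
    apply: ler_pM => //; rewrite ?exprn_ge0 ?invr_ge0 ?lerDl //.
    by rewrite ler_wiXn2l // ?invr_ge0 //; case/andP: q1 => _ /ltW.
  by rewrite -ler_pdivlMr // ltW.
exists I, (fun i => (Q i).2), (fun i => (Q i).1); split.
- by move=> i; have [] := hQ i.
- by move=> i; have [_ [n [e [-> oe _ _ _]]]] := hQ i; apply: transfer_projection.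
- move=> i j [ij _ _].
  have [_ [n [e [-> oe es eT _]]]] := hQ i.
  have [_ [m [f [-> of_ fs _ _]]]] := hQ j.
  apply: transfer_op_le => // l; apply: eT; first exact: transfer_linear.
  by move=> x /ij/fs.
- move=> a Aa; split=> x; apply: tails_cvg => eps eps0.
    have [N hN] := small (nrm x) eps (dotnorm_ge0 _ _) eps0.
    exists ([:: x; pi a x], [:: a], N) => j [js jt jN].
    have [_ [n [e [Qe oe es _ eA]]]] := hQ j.
    rewrite normr_hnorm lecR hnormE dotnormB /= Qe.
    have ex : transfer e e x = x by apply/es/js; rewrite mem_head.
    have epx : transfer e e (pi a x) = pi a x.
      by apply/es/js; rewrite !inE eqxx orbT.
    rewrite ex; set d := _ - _.
    have dE : d = transfer e e ((Q j).2 a x - pi a x).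
      by rewrite (lin_B (transfer_linear e e)) epx.
    have ed : transfer e e d = d by rewrite dE transfer_comp.
    apply: le_trans (hN _ jN); apply: nrm_le_sqr.
      by rewrite mulr_ge0 ?dotnorm_ge0 ?(ltW (prec0 j)).
    have at_ : a \in j.1.2 by apply: jt; rewrite mem_head.
    apply: le_trans (eA a at_ Aa x d ex ed).
    rewrite -Re_dot_sqr {1}dE transfer_adj ed dotBl.
    exact: le_trans (ler_norm _) (ler_Re_cabs _).
  set S := adjoint (pi a).
  have bpi := rep_bounded rpi Aa.
  have [N hN] := small (nrm x) eps (dotnorm_ge0 _ _) eps0.
  exists ([:: x; S x], [:: a], N) => j [js jt jN].
  have [[rj _] [n [e [Qe oe es _ eA]]]] := hQ j.
  rewrite normr_hnorm lecR hnormE dotnormB /= Qe.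
  have bj : bounded_ops (transfer e e \o (Q j).2 a \o transfer e e).
    apply/bounded_opsE; split=> [c u v|] /=.
      rewrite (transfer_linear e e) (rep_linear rj Aa c).
      by rewrite (transfer_linear e e).
    exists (norm1 a) => u; apply: le_trans (transfer_norm _ oe oe) _.
    apply: le_trans (rep_norm rj _ Aa) _.
    by rewrite ler_wpM2l ?transfer_norm // norm1_ge0 //; apply: (alg_bounded hA).
  have adj := adjointP bj; set Sj := adjoint _ in adj *.
  have ex : transfer e e x = x by apply/es/js; rewrite mem_head.
  have esx : transfer e e (S x) = S x.
    by apply/es/js; rewrite !inE eqxx orbT.
  have eSj : transfer e e (Sj x) = Sj x.
    apply: (@dot_ext _ _ (inner H)) => z; rewrite dotC [RHS]dotC; congr Num.conj.
    by rewrite -transfer_adj -!adj /= transfer_comp.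
  set d := _ - _.
  have ed : transfer e e d = d.
    by rewrite /d (lin_B (transfer_linear e e)) eSj esx.
  apply: le_trans (hN _ jN); apply: nrm_le_sqr.
    by rewrite mulr_ge0 ?dotnorm_ge0 ?(ltW (prec0 j)).
  have at_ : a \in j.1.2 by apply: jt; rewrite mem_head.
  have := eA a at_ Aa d x ed ex; rewrite mulrAC; apply: le_trans.
  rewrite -Re_dot_sqr {2}/d dotBr -adj /= ed -(adjointP bpi) transfer_adj ex.
  exact: le_trans (ler_norm _) (ler_Re_cabs _).
move=> a Aa x y; apply: tails_cvg => eps eps0.
have [N hN] := small (nrm x * nrm y) eps (mulr_ge0 (dotnorm_ge0 _ _) (dotnorm_ge0 _ _)) eps0.
exists ([:: x; y], [:: a], N) => j [js jt jN].
have [_ [n [e [Qe oe es _ eA]]]] := hQ j.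
rewrite cabsE lecR -cabsN opprB.
have ex : transfer e e x = x by apply/es/js; rewrite mem_head.
have ey : transfer e e y = y by apply/es/js; rewrite !inE eqxx orbT.
have at_ : a \in j.1.2 by apply: jt; rewrite mem_head.
apply: le_trans (eA a at_ Aa x y ex ey) _.
by rewrite -mulrA; apply: hN.
Qed.

End Nets.

Section LowerSemicontinuity.
Variables (R : realType) (K : hilbertType R) (A : set (K -> K)).
Hypothesis hA : is_operator_algebra A.

(** If the matrix coefficients of a are approximated by those of finite
    dimensional representations on vectors that are not longer, then the norm
    of a is at most the supremum of its norms in these representations; each of
    them restricts to a space of finite dimension that contains its carrier and
    the vectors at hand. *)
Lemma rfd_of_approximation :
  (forall n (a : 'M[K -> K]_n) (x y : 'I_n -> K) (eps : R), mx_in A a -> 0 < eps ->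
     exists (pi : (K -> K) -> (K -> K)) (x' y' : 'I_n -> K),
       [/\ finite_dim_representation A pi, tnrm x' <= tnrm x, tnrm y' <= tnrm y &
           cabs (tdot (mxop a x) y - tdot (amplify pi a x') y') <= eps]) ->
  RFD A.
Proof.
move=> app n a Aa.
set E := [set r | _].
have ba i j : bounded_ops (a i j) := alg_bounded hA (Aa i j).
have N0 : 0 <= mxopnorm a by apply: mxopnorm_ge0.
have ubE r : E r -> r <= mxopnorm a.
  by move=> [G [_ [s [_ _ _ cc] ->]]]; apply: cc.
apply/eqP; rewrite eq_le; apply/andP; split; last exact: sup_le_nneg.
have key x y (eps : R) : 0 < eps ->
    0 <= sup E /\ cabs (tdot (mxop a x) y) <= sup E * tnrm x * tnrm y + eps.
  move=> eps0; have [pi [x' [y' [[rpi fpi] xx yy near]]]] := app n a x y eps Aa eps0.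
  have [n0 [e0 [oe0 fe0]]] := finite_dim_orthonormal fpi.
  have [m [w [oe fe _]]] := orthonormal_ext
    ([seq x' i | i : 'I_n] ++ [seq y' i | i : 'I_n]) oe0.
  set e := tcat e0 w in oe fe.
  have epi b z : A b -> transfer e e (pi b z) = pi b z.
    move=> Ab; apply: fixed_tcatl => //; apply: fe0; apply: subset_closure.
    move=> F [_ sF]; apply: sF; exists (pi b); last by exists z.
    by move=> B [_ sB]; apply: sB; exists b.
  have ex i : transfer e e (x' i) = x' i.
    by apply: fe; rewrite mem_cat map_f // mem_enum.
  have ey i : transfer e e (y' i) = y' i.
    by apply: fe; rewrite mem_cat [X in _ || X]map_f ?orbT // mem_enum.
  have [G [f [of_ fI]]] := finite_dim_model oe.
  pose s := transfer_rep e f pi.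
  have rs : is_representation A s.
    by apply: transfer_rep_representation => // b z Ab; apply: epi.
  have Es : E (mxopnorm (map_mx s a)).
    exists G; split; last by exists s.
    by apply: (orthonormal_finite_dim (e := f)) => z _; apply: fI.
  have bs i j : bounded_ops (map_mx s a i j) by apply: (amp_bounded rs Aa).
  have s_le : mxopnorm (map_mx s a) <= sup E.
    apply: sup_upper_bound => //; split; first by exists (mxopnorm (map_mx s a)).
    by exists (mxopnorm a).
  have s0 : 0 <= sup E by apply: le_trans s_le; apply: mxopnorm_ge0.
  split=> //.
  pose X i := transfer e f (x' i); pose Y i := transfer e f (y' i).
  have XY : tdot (amplify s a X) Y = tdot (amplify pi a x') y'.
    apply: eq_bigr => i _; rewrite /amplify /mxop !dot_suml; apply: eq_bigr => j _.
    rewrite [map_mx s a i j]mxE [map_mx pi a i j]mxE /s /transfer_rep /X /Y.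
    by rewrite transfer_comp // ex transfer_isom // epi.
  have nX : tnrm X <= tnrm x.
    by apply: le_trans xx; apply: tnrm_le => i; apply: transfer_norm.
  have nY : tnrm Y <= tnrm y.
    by apply: le_trans yy; apply: tnrm_le => i; apply: transfer_norm.
  rewrite -[tdot _ y](subrK (tdot (amplify pi a x') y')) addrC.
  apply: le_trans (cabsD _ _) _; apply: lerD near; rewrite -XY.
  apply: le_trans (dot_CS _ _ _) _; apply: ler_pM; rewrite ?dotnorm_ge0 //.
  apply: le_trans (le_mxopnorm bs X) _.
  by apply: ler_pM; rewrite ?dotnorm_ge0 // mxopnorm_ge0.
have s0 : 0 <= sup E by have [] := key 0 0 1 ltr01.
apply: mxopnorm_le => // x.
apply: (@dotnorm_le_dot _ _ (@tdot R K n)) => [|y].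
  by rewrite mulr_ge0 ?dotnorm_ge0.
by apply/ler_addgt0Pr => eps /(key x y)[].
Qed.

Lemma wot_matrix (I : directedType) (u : I -> (K -> K) -> (K -> K)) n
    (a : 'M[K -> K]_n) (x y : 'I_n -> K) (eps : R) : mx_in A a -> 0 < eps ->
  (forall b, A b -> WOT_cvg (fun i => u i b) b) ->
  exists i, cabs (tdot (mxop a x) y - tdot (amplify (u i) a x) y) <= eps.
Proof.
move=> Aa eps0 hu.
pose d := eps / (n%:R ^+ 2 + 1).
have n0 : 0 < n%:R ^+ 2 + 1 :> R by rewrite ltr_wpDl ?sqr_ge0.
have d0 : 0 < d by rewrite divr_gt0.
have [i hi] : exists i, forall kj : 'I_n * 'I_n,
    `|inner K (a kj.1 kj.2 (x kj.2)) (y kj.1) -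
      inner K (u i (a kj.1 kj.2) (x kj.2)) (y kj.1)| <= d%:C%C.
  apply: tails_ex.
  apply: (@filter_forall _ _ (fun kj => [set i : I |
    `|inner K (a kj.1 kj.2 (x kj.2)) (y kj.1) -
      inner K (u i (a kj.1 kj.2) (x kj.2)) (y kj.1)| <= d%:C%C]) (@tails I)).
  move=> kj; exact: cvg_tails (hu _ (Aa _ _) _ _) d0.
exists i; rewrite /tdot -sumrB; apply: le_trans (cabs_sum _ _ _) _.
apply: (@le_trans _ _ (\sum_(k < n) \sum_(j < n) d)).
  apply: ler_sum => k _; rewrite /amplify /mxop !dot_suml -sumrB.
  apply: le_trans (cabs_sum _ _ _) _; apply: ler_sum => j _.
  by rewrite [map_mx _ _ _ _]mxE -lecR -cabsE; apply: (hi (k, j)).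
rewrite sum2_const.
by rewrite /d mulrCA ler_piMr ?(ltW eps0) // ler_pdivrMr // mul1r lerDl.
Qed.

Lemma id_representation : is_representation A id.
Proof.
split=> // [a|n a Aa]; first exact: (alg_bounded hA).
by rewrite map_mx_id.
Qed.

Lemma sot_wot (I : directedType) (H : hilbertType R) (u : I -> H -> H) T :
  SOT_cvg u T -> WOT_cvg u T.
Proof.
move=> hu x y; apply: tails_cvg => eps eps0.
have n1 : 0 < nrm y + 1 by rewrite ltr_wpDl ?dotnorm_ge0.
have [i _ hi] := cvg_tails (hu x) (divr_gt0 eps0 n1).
exists i => j /hi /=; rewrite normr_hnorm lecR hnormE ler_pdivlMr // => h.
rewrite cabsE lecR -dotBl; apply: le_trans (dot_CS _ _ _) _.
by apply: le_trans h; rewrite ler_wpM2l ?dotnorm_ge0 // lerDl.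
Qed.

Lemma projection_selfadjoint (H : hilbertType R) (P : H -> H) x y :
  is_projection P -> inner H (P x) y = inner H x (P y).
Proof. by move=> [bP _ PP]; rewrite (adjointP bP) PP. Qed.

Lemma projection_norm (H : hilbertType R) (P : H -> H) x :
  is_projection P -> nrm (P x) <= nrm x.
Proof.
move=> pP; have [_ PP _] := pP; apply: nrm_le_sqr (dotnorm_ge0 _ _) _.
rewrite -Re_dot_sqr projection_selfadjoint // -[P (P x)]/((P \o P) x) PP.
exact: Re_dot_CS.
Qed.

Lemma rfd_of_compressions (I : directedType) (pi_ : I -> (K -> K) -> (K -> K))
    (P_ : I -> K -> K) :
  (forall i, finite_dim_representation A (pi_ i)) ->
  (forall i, is_projection (P_ i)) ->
  (forall a, A a -> WOT_cvg (fun i => P_ i \o pi_ i a \o P_ i) a) ->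
  RFD A.
Proof.
move=> fpi pP cvg; apply: rfd_of_approximation => n a x y eps Aa eps0.
have [i hi] := wot_matrix x y Aa eps0 cvg.
exists (pi_ i), (fun j => P_ i (x j)), (fun j => P_ i (y j)); split=> //.
- by apply: tnrm_le => j; apply: projection_norm.
- by apply: tnrm_le => j; apply: projection_norm.
move: hi; congr (cabs (_ - _) <= _); apply: eq_bigr => k _.
rewrite /amplify /mxop !dot_suml; apply: eq_bigr => j _.
by rewrite [map_mx _ _ _ _]mxE [map_mx _ _ _ _]mxE /= projection_selfadjoint.
Qed.

End LowerSemicontinuity.

Unset Implicit Arguments.
Theorem corollary2p4 (R : realType) (K : hilbertType R)
    (A : set (K -> K)) (hA : is_operator_algebra A) :
  [<-> RFD A;
       forall (H : hilbertType R) (pi : (K -> K) -> (H -> H)),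
         is_representation A pi ->
         exists (I : directedType) (pi_ : I -> (K -> K) -> (H -> H))
                (P_ : I -> H -> H),
           [/\ forall i, finite_dim_representation A (pi_ i),
               forall i, is_projection (P_ i) /\ finite_rank (P_ i),
               increasing_net P_ &
               forall a, A a ->
                 SOTstar_cvg (fun i => P_ i \o pi_ i a \o P_ i) (pi a)];
       forall (H : hilbertType R) (pi : (K -> K) -> (H -> H)),
         is_representation A pi ->
         exists (I : directedType) (pi_ : I -> (K -> K) -> (H -> H)),
           (forall i, finite_dim_representation A (pi_ i)) /\
           (forall a, A a -> WOT_cvg (fun i => pi_ i a) (pi a))].
Proof.
tfae.
- move=> rfd H pi rpi.
  have [I [pi_ [P_ [h1 h2 h3 h4 _]]]] := rfd_approximating_net hA rfd rpi.
  by exists I, pi_, P_.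
- move=> h; have [I [pi_ [P_ [h1 h2 _ h4]]]] := h K id (id_representation hA).
  have rfd : RFD A.
    apply: (rfd_of_compressions hA h1 (fun i => (h2 i).1)) => a Aa.
    by apply: sot_wot; have [] := h4 a Aa.
  move=> H pi rpi.
  have [J [rho [_ [g1 _ _ _ g5]]]] := rfd_approximating_net hA rfd rpi.
  by exists J, rho.
move=> h; have [I [pi_ [h1 h2]]] := h K id (id_representation hA).
by apply: (rfd_of_compressions hA h1 (fun=> @id_projection R K)) => a Aa; apply: h2.
Qed.
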